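(* Let $d\geq 1$ and let $\omega=(\omega_x)_{x\in\mathbb{Z}}$ be an i.i.d. environment with law $\mathsf{P}$, with $\rho_0=(1-\omega_0)/\omega_0$. Assume that: (i) there exists $\varepsilon_0\in(0,1/2)$ such that $\mathsf{P}[\varepsilon_0\leq\omega_0\leq 1-\varepsilon_0]=1$; (ii) $\mathsf{E}(\log\rho_0)<0$; (iii) there exists $\kappa>0$ such that $\mathsf{E}(\rho_0^{\kappa})=1$, and this $\kappa$ satisfies $\kappa>1/2$. Let $x_1,\dots,x_d,z_1\in\mathbb{Z}$. Then $\mathbb{P}^{(x_1,\dots,x_d,z_1)}$-almost surely, the number of $n\in\mathbb{N}$ such that $$S_n^{(1)}=S_n^{(2)}=\dots=S_n^{(d)}=Z_n$$ is finite.
   Context: $\mathbb{N}=\{0,1,2,\dots\}$ and $\log$ is the natural logarithm. The environment $\omega=(\omega_x)_{x\in\mathbb{Z}}$ is a collection of i.i.d. random variables with values in $(0,1)$ and joint law $\mathsf{P}$; $\mathsf{E}$ is expectation under $\mathsf{P}$; $\rho_x:=(1-\omega_x)/\omega_x$ for $x\in\mathbb{Z}$. Under (i), (ii), (iii) the number $\kappa$ is unique. Given $\omega$ and $(x_1,\dots,x_d,z_1)\in\mathbb{Z}^{d+1}$, under the quenched law $P_\omega^{(x_1,\dots,x_d,z_1)}$ the processes $(S_n^{(j)})_{n\in\mathbb{N}}$, $1\leq j\leq d$, and $(Z_n)_{n\in\mathbb{N}}$ are $d+1$ independent Markov chains on $\mathbb{Z}$ with $S_0^{(j)}=x_j$ for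 $1\leq j\leq d$, $Z_0=z_1$, and the following transition probabilities. Each $S^{(j)}$ (a random walk in the random environment $\omega$, the same $\omega$ for all $j$) jumps from $y$ to $y+1$ with probability $\omega_y$ and from $y$ to $y-1$ with probability $1-\omega_y$. The chain $Z$ (simple random walk) jumps from $y$ to $y+1$ with probability $1/2$ and from $y$ to $y-1$ with probability $1/2$. The annealed law is $\mathbb{P}^{(x_1,\dots,x_d,z_1)}(\cdot):=\int P_\omega^{(x_1,\dots,x_d,z_1)}(\cdot)\,\mathsf{P}(\mathrm{d}\omega)$. *)

(* Defs.v *)
From HB Require Import structures.
From mathcomp Require Import all_boot all_order all_algebra.
From mathcomp Require Import all_classical all_reals all_analysis.

Set Implicit Arguments.
Unset Strict Implicit.
Unset Printing Implicit Defensive.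

Import Order.TTheory GRing.Theory Num.Theory.
Import numFieldNormedType.Exports.

Local Open Scope classical_set_scope.
Local Open Scope ring_scope.

(* The library equips [nat] and [bool], but not [int], with the discrete
   sigma-algebra. *)
HB.instance Definition _ := isPointed.Build int 0.
HB.instance Definition _ := @isMeasurable.Build default_measure_display int
  discrete_measurable discrete_measurable0
  discrete_measurableC discrete_measurableU.

Section independence.
Context d (T : measurableType d) (R : realType).

(* Product rule over every finite subfamily of a possibly infinite family [G]
   of sigma-algebras. *)
Definition mutual_independence (mu : {measure set T -> \bar R})
    (I : choiceType) (G : I -> set_system T) : Prop :=
  forall (J : seq I) (A : I -> set T), uniq J ->
    (forall i, i \in J -> G i (A i)) ->
    mu (\bigcap_(i in [set` J]) A i) = (\prod_(i <- J) mu (A i))%E.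

Definition sigma_rv d' (U : measurableType d') (X : {mfun T >-> U}) :
    set_system T :=
  preimage_set_system [set: T] X measurable.

Definition sigma_process d' (U : measurableType d')
    (X : nat -> {mfun T >-> U}) : set_system T :=
  <<s \bigcup_n sigma_rv (X n) >>.

End independence.

(* The laws are compared on measurable sets only: the values of a measure
   elsewhere are meaningless. *)
Definition iid d (T : measurableType d) (R : realType) (P : probability T R)
    (omega : int -> {RV P >-> R}) : Prop :=
  mutual_independence P (fun x => sigma_rv (omega x)) /\
  forall (x y : int) (B : set R), measurable B ->
    distribution P (omega x) B = distribution P (omega y) B.

Definition rho d (T : measurableType d) (R : realType) (P : probability T R)
    (omega : int -> {RV P >-> R}) (x : int) (w : T) : R :=
  (1 - omega x w) / omega x w.

Section markov_chains.
Context d (T : measurableType d) (R : realType).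
Variable mu : {measure set T -> \bar R}.

(* The second clause is
   [mu (X_(n+1) = s_(n+1) | X_0 = s_0, ..., X_n = s_n) = p s_n s_(n+1)],
   multiplied out so that no history has to be assumed of positive mass. *)
Definition markov_chain (p : int -> int -> R) (x : int)
    (X : nat -> {mfun T >-> int}) : Prop :=
  mu [set t | X 0%N t = x] = 1%E /\
  forall (n : nat) (s : nat -> int),
    mu [set t | forall k, (k <= n.+1)%N -> X k t = s k] =
    (mu [set t | forall k, (k <= n)%N -> X k t = s k] *
     (p (s n) (s n.+1))%:E)%E.

Definition nearest_neighbour (a : int -> R) (y y' : int) : R :=
  if y' == y + 1 then a y else if y' == y - 1 then 1 - a y else 0.

(* The d + 1 processes are indexed by [option 'I_dim], [None] being the index
   of [Z]. *)
Definition quenched_law (dim : nat) (o : int -> R) (x : 'I_dim -> int)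
    (z : int) (S : 'I_dim -> nat -> {mfun T >-> int})
    (Z : nat -> {mfun T >-> int}) : Prop :=
  [/\ forall j, markov_chain (nearest_neighbour o) (x j) (S j),
      markov_chain (nearest_neighbour (fun=> 2^-1)) z Z &
      mutual_independence mu
        (fun i : option 'I_dim =>
           sigma_process (if i is Some j then S j else Z))].

End markov_chains.

Section annealed.
Local Open Scope ereal_scope.
Context d d' (W : measurableType d) (T : measurableType d') (R : realType).
Variables (P : probability W R) (Q : R.-pker W ~> T).

Definition annealed_law (A : set T) : \bar R := \int[P]_w Q w A.

Let annealed_law0 : annealed_law set0 = 0.
Proof. by rewrite /annealed_law integral0_eq// => w _; rewrite measure0. Qed.

Let annealed_law_ge0 A : 0 <= annealed_law A.
Proof. exact: integral_ge0. Qed.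

Let annealed_law_sigma_additive : semi_sigma_additive annealed_law.
Proof.
move=> F mF tF mUF; rewrite [X in _ --> X](_ : _ =
    \int[P]_w (\sum_(n <oo) Q w (F n)))%E; last first.
  apply: eq_integral => w _; apply/esym/cvg_lim => //.
  exact/measure_semi_sigma_additive.
apply/cvg_closeP; split.
  by apply: is_cvg_nneseries => n *; exact: integral_ge0.
rewrite closeE// integral_nneseries// => n.
exact: measurable_kernel.
Qed.

HB.instance Definition _ := isMeasure.Build _ _ _ annealed_law
  annealed_law0 annealed_law_ge0 annealed_law_sigma_additive.

Let annealed_lawT : annealed_law [set: T] = 1.
Proof.
rewrite /annealed_law (eq_integral (cst 1)) => [|w _]; last exact: prob_kernel.
by rewrite integral_cst//= mul1e; exact: probability_setT.
Qed.

HB.instance Definition _ := Measure_isProbability.Build _ _ _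
  annealed_law annealed_lawT.

End annealed.

(* Main.v *)
Require Import Defs.
From mathcomp Require Import all_boot all_order all_algebra finmap.
From mathcomp Require Import all_classical all_reals all_analysis.
From mathcomp Require Import measurable_realfun zify ring lra.

Import Order.TTheory GRing.Theory Num.Theory.
Import numFieldNormedType.Exports.

Local Open Scope classical_set_scope.
Local Open Scope ring_scope.

(** Why the meetings are finite in number. It suffices that one of the walks,
    call it [S], eventually stays strictly above [Z]. Fix [alpha] with
    [2 < alpha ^+ 2] and [alpha < 2], and compare both walks, at the times [n]
    of the dyadic block [2 ^ k <= n < 2 ^ k.+1], with the level
    [L = truncn (alpha ^+ k)] above the starting point of [S]. This level is a
    power of [n] with exponent above 1/2, so [Z] is below it by a Chernoff
    bound ([srw_upper_tail]). If the exponent is also below [kappa] and 1, then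
    [S] is above it. Both statements fail with summable quenched probability,
    for almost every environment, and Borel-Cantelli concludes.

    Borel-Cantelli only involves the laws of the walks at one time. If [K] is
    the one-step averaging operator of a chain, then the chain is in [B] at
    time [n] with probability [K^n 1_B] at the starting point
    ([markov_chain_law]), and [K^n 1_B] is bounded by comparison with a
    well-chosen function.

    For [S] in a fixed environment, the comparison functions come from the
    following game. The walk pays [eta ^- tau i] at each visit to the site
    [b + i], for [0 <= i <= M] and a nondecreasing 1-Lipschitz [tau], until it
    reaches [b + N]. The expected total payment ([lyapunov]) is nonincreasing
    in the starting point and, before that time, decreases on average at each
    step by exactly the payment. The main point is [potential_le]: starting
    from [i], it is at most [A * eta ^- tau i], with one constant [A]
    ([total_cost]) for all [tau]. With [tau i = i] this says that backtracking
    by [L] costs a factor [eta ^- L]. With [tau i = i - 2 L] (truncated) it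
    says that the function loses a proportion [A^-1] of its value per step, up
    to errors of size [eta ^- L], so that being below [x + L] at time [n] has
    probability about [A * (1 - A^-1) ^+ n] ([slow_walk_bound]).

    It remains to see that [A] is much smaller than [2 ^ k]. It is a polynomial
    in the ratios [rho], so for [s <= 1] subadditivity of the power [s] bounds
    [A `^ s] by the same polynomial in [rho `^ s] and [eta `^ s], whose
    expectation is explicit by independence and is of order [L] as soon as
    [eta `^ s * E (rho `^ s) < 1]. Such an [eta > 1] exists when
    [0 < s < kappa], because [E (rho `^ s) < 1] there: the function
    [s |-> E (rho `^ s)] has value 1 at 0 and at [kappa] and is strictly
    convex, as [rho] is not almost surely 1 ([subcritical_moment]). As
    [kappa > 1/2], some [s > 1/2] is allowed, and one can choose
    [alpha < beta < 2 `^ s] with [2 < alpha ^+ 2]. By Markov's inequality and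
    Borel-Cantelli [A `^ s <= beta ^+ k] eventually, that is, [A] is at most
    the [k]-th power of [beta `^ s^-1 < 2]. *)

(** * One-time laws of a nearest-neighbour chain *)

(** The transition operator, acting on functions rather than on laws: iterating
    it gives the one-time probabilities of the chain by a recursion in [R]. *)
Definition nn_step {R : realType} (a : int -> R) (psi : int -> R) (y : int) : R :=
  a y * psi (y + 1) + (1 - a y) * psi (y - 1).

Lemma nn_step_mono {R : realType} (a : int -> R) (psi1 psi2 : int -> R) (y : int) :
  0 <= a y <= 1 -> psi1 (y + 1) <= psi2 (y + 1) -> psi1 (y - 1) <= psi2 (y - 1) ->
  nn_step a psi1 y <= nn_step a psi2 y.
Proof. by move=> /andP[a0 a1] h1 h2; apply: lerD; apply: ler_wpM2l; lra. Qed.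

Lemma iter_nn_step_mono {R : realType} (a : int -> R) (psi1 psi2 : int -> R) n :
  (forall y, 0 <= a y <= 1) -> (forall y, psi1 y <= psi2 y) ->
  forall y, iter n (nn_step a) psi1 y <= iter n (nn_step a) psi2 y.
Proof.
by move=> a01 h; elim: n => // n IH y; rewrite !iterS; apply: nn_step_mono.
Qed.

Section marginal_law.
Context {d} {T : measurableType d} {R : realType}.
Variable mu : {measure set T -> \bar R}.
Hypothesis mu1 : mu [set: T] = 1%E.
Variables (a : int -> R) (x : int) (X : nat -> {mfun T >-> int}).
Hypothesis chainX : markov_chain mu (nearest_neighbour a) x X.

Let cyl (m : nat) (s : nat -> int) : set T :=
  [set t | forall k, (k <= m)%N -> X k t = s k].

Lemma measurable_state (n : nat) (B : set int) : measurable [set t | B (X n t)].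
Proof. by rewrite -[X in measurable X]/(X n @^-1` B); exact: measurable_funPTI. Qed.

Let mcyl m s : measurable (cyl m s).
Proof.
have -> : cyl m s = \bigcap_(k in `I_m.+1) [set t | [set s k] (X k t)].
  by apply/seteqP; split => t /= h k /=; [move=> km; exact: h|move=> km; apply: h].
apply: bigcap_measurable => //; first by exists 0%N.
by move=> k _; exact: measurable_state.
Qed.

Let fin_cyl (E : set T) : measurable E -> mu E \is a fin_num.
Proof.
move=> mE; rewrite ge0_fin_numE//; apply: (@le_lt_trans _ _ 1%E); last exact: ltey.
by rewrite -mu1; apply: le_measure; rewrite ?inE.
Qed.

Let next (m : nat) (s : nat -> int) (y : int) (k : nat) :=
  if (k <= m)%N then s k else y.

Let cyl_next m s y : cyl m.+1 (next m s y) = cyl m s `&` [set t | X m.+1 t = y].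
Proof.
apply/seteqP; split => t /=.
  move=> h; split.
    by move=> k km; have := h k (leqW km); rewrite /next km.
  by have := h m.+1 (leqnn _); rewrite /next ltnn.
move=> [h1 h2] k; rewrite leq_eqVlt => /orP[/eqP ->|]; rewrite /next.
  by rewrite ltnn.
by rewrite ltnS => km; rewrite km; exact: h1.
Qed.

Let mu_next m s y : mu (cyl m s `&` [set t | X m.+1 t = y]) =
  (mu (cyl m s) * (nearest_neighbour a (s m) y)%:E)%E.
Proof.
rewrite -cyl_next /cyl; case: chainX => _ /(_ m (next m s y)) ->.
rewrite /next leqnn ltnn; congr (mu _ * _)%E.
by apply/seteqP; split => t /= h k km; have := h k km; rewrite km.
Qed.

Let nn_up y : nearest_neighbour a y (y + 1) = a y.
Proof. by rewrite /nearest_neighbour eqxx. Qed.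

Let nn_down y : nearest_neighbour a y (y - 1) = 1 - a y.
Proof. by rewrite /nearest_neighbour eqxx; case: eqP => //; lia. Qed.

(** The transition probabilities of the two admissible jumps add up to one, so the
    part [N] of the history that makes another jump is null. *)
Let split_next m s (E : set T) : measurable E ->
  mu (cyl m s `&` E) = (mu (cyl m.+1 (next m s (s m + 1)) `&` E) +
                        mu (cyl m.+1 (next m s (s m - 1)) `&` E))%E.
Proof.
move=> mE.
have mX y : measurable [set t | X m.+1 t = y] by exact: (measurable_state _ [set y]).
pose U := cyl m s `&` [set t | X m.+1 t = s m + 1].
pose D := cyl m s `&` [set t | X m.+1 t = s m - 1].
pose N := cyl m s `\` (U `|` D).
have mU : measurable U by exact: measurableI.
have mD : measurable D by exact: measurableI.
have mN : measurable N by apply: measurableD => //; exact: measurableU.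
have UD0 : U `&` D = set0.
  by rewrite -subset0 => t [[_ /= e1] [_ /=]]; rewrite e1; lia.
have decomp F : measurable F -> mu (cyl m s `&` F) =
    (mu (U `&` F) + mu (D `&` F) + mu (N `&` F))%E.
  move=> mF; rewrite -measureU; [|exact: measurableI|exact: measurableI|]; last first.
    by rewrite setIACA UD0 set0I.
  rewrite -measureU; [|by apply: measurableU; exact: measurableI|exact: measurableI|].
    by rewrite -!setIUl /N setDUK// => t [] [].
  by rewrite -setIUl setIACA /N -subset0 => t [[h [_ []]]].
have N0 : mu N = 0%E.
  have := decomp setT measurableT; rewrite !setIT /U /D !mu_next nn_up nn_down.
  have /fineK <- := fin_cyl _ (mcyl m s); have /fineK <- := fin_cyl _ mN.
  by rewrite -!EFinM -!EFinD => -[] h; congr EFin; lra.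
rewrite decomp// !cyl_next -/U -/D.
have mNE : measurable (N `&` E) by exact: measurableI.
by rewrite (subset_measure0 mNE mN (@subIsetl _ N E) N0) adde0.
Qed.

Let cyl_law n (B : set int) : forall m s,
  mu (cyl m s `&` [set t | B (X (m + n)%N t)]) =
  (mu (cyl m s) * (iter n (nn_step a) (\1_B : int -> R) (s m))%:E)%E.
Proof.
elim: n => [|n IH] m s.
  rewrite addn0 /= indicE; have [sB|sB] := boolP (s m \in B).
    rewrite mule1; congr (mu _); apply/seteqP; split => [t []//|t h]; split => //=.
    by rewrite (h m)//; exact/set_mem.
  rewrite mule0 (_ : _ `&` _ = set0) ?measure0// -subset0 => t [h /=].
  by rewrite (h m)// => hB; case/negP: sB; exact/mem_set.
rewrite split_next; last exact: measurable_state.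
rewrite addnS -addSn !IH [in RHS]iterS /nn_step !cyl_next !mu_next nn_up nn_down.
rewrite /next ltnn.
have /fineK <- := fin_cyl _ (mcyl m s).
by rewrite -!EFinM -EFinD; congr EFin; ring.
Qed.

(** The hypothesis on the chain is about whole histories; conditioning on the
    history up to time [m] and splitting according to the next position reduces
    the claim for [n.+1] more steps to the claim for [n].  Only
    finitely many events occur at each stage, because a history is followed by a
    jump of size one up to a null event. *)
Lemma markov_chain_law n (B : set int) :
  mu [set t | B (X n t)] = (iter n (nn_step a) (\1_B : int -> R) x)%:E.
Proof.
have cyl0 : cyl 0 (fun=> x) = [set t | X 0%N t = x].
  by apply/seteqP; split => t /= h; [exact: h|case].
have m0 : mu (cyl 0 (fun=> x)) = 1%E by rewrite cyl0; case: chainX.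
have := cyl_law n B 0 (fun=> x); rewrite m0 mul1e add0n => <-.
have mB := measurable_state n B; have mC := mcyl 0 (fun=> x).
have muC : mu (~` cyl 0 (fun=> x)) = 0%E.
  have : mu setT = (mu (~` cyl 0 (fun=> x)) + mu (cyl 0 (fun=> x)))%E.
    by rewrite {1}(measureDI mu measurableT mC) setTI setTD.
  rewrite m0 mu1.
  have /fineK <- := fin_cyl _ (measurableC mC).
  by rewrite -EFinD => -[] h; congr EFin; lra.
rewrite [LHS](measureDI mu mB mC) setIC.
by rewrite (subset_measure0 (measurableD mB mC) (measurableC mC) _ muC) ?add0e// => t [].
Qed.

End marginal_law.

(** * A Lyapunov function for the walk in a fixed environment *)

(** One-step recursion [u_x = m_x * u_(x-1) + s_x] with [u_(-1) = 0].  Both the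
    increments of the Lyapunov function and the environment cost that
    bounds them have this form, which lets them be compared term by term. *)
Fixpoint affine_rec {R : realType} (m s : nat -> R) (x : nat) : R :=
  if x is x'.+1 then m x * affine_rec m s x' + s x else s 0%N.

Lemma affine_rec_ge0 {R : realType} (m s : nat -> R) x :
  (forall i, 0 <= m i) -> (forall i, 0 <= s i) -> 0 <= affine_rec m s x.
Proof.
by move=> m0 s0; elim: x => //= x IH; rewrite addr_ge0// mulr_ge0.
Qed.

Lemma affine_rec_ge {R : realType} (m s : nat -> R) x :
  (forall i, 0 <= m i) -> (forall i, 0 <= s i) -> s x <= affine_rec m s x.
Proof.
by move=> m0 s0; case: x => //= x; rewrite lerDr mulr_ge0// affine_rec_ge0.
Qed.

Definition env_ratio {R : realType} (a : int -> R) (b : int) (i : nat) : R :=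
  (1 - a (b + i%:Z)) / a (b + i%:Z).

(** The constant [A]: the term of index [x] bounds the expected payment on the way
    from [b + x] to [b + x.+1], measured in units of [eta ^- tau x].  The
    factor [eta] makes up for sites further left being more expensive.  It
    is the only quantity through which the environment enters the bounds. *)
Definition total_cost {R : realType} (rho : nat -> R) (eta : R) (M N : nat) : R :=
  \sum_(0 <= x < N)
    affine_rec (fun i => eta * rho i) (fun i => (i <= M)%N%:R * (1 + rho i)) x.

Section lyapunov.
Context {R : realType}.
Variables (a : int -> R) (b : int) (eta : R) (M N : nat).
Hypothesis a01 : forall y, 0 < a y < 1.
Hypothesis eta1 : 1 < eta.

Let rho := env_ratio a b.
Let A := total_cost rho eta M N.
Let w := affine_rec (fun i => eta * rho i) (fun i => (i <= M)%N%:R * (1 + rho i)).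

Let rho_ge0 i : 0 <= rho i.
Proof.
by have /andP[? ?] := a01 (b + i%:Z); rewrite /rho /env_ratio divr_ge0//; lra.
Qed.

Let aD1rho i : a (b + i%:Z) * (1 + rho i) = 1.
Proof.
have /andP[? ?] := a01 (b + i%:Z); rewrite /rho /env_ratio; field; lra.
Qed.

Let eta_gt0 : 0 < eta. Proof. by apply: lt_trans eta1. Qed.

Let w_ge0 x : 0 <= w x.
Proof.
by apply: affine_rec_ge0 => i; rewrite mulr_ge0// ?ler0n// ?addr_ge0// ltW.
Qed.

Lemma total_cost_ge1 : (0 < N)%N -> 1 <= A.
Proof.
move=> N0; rewrite /A /total_cost (big_ltn N0) [X in 1 <= X + _]/= mulr1n mul1r.
by rewrite -addrA lerDl addr_ge0//; apply: sumr_ge0 => i _; exact: w_ge0.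
Qed.

Section weight.
Variable tau : nat -> nat.
Hypothesis tau_nd : forall i j, (i <= j)%N -> (tau i <= tau j)%N.
Hypothesis tau_lip : forall i, (tau i.+1 <= (tau i).+1)%N.

(** The payment at the site [b + i]. *)
Definition source_weight (i : nat) : R := (i <= M)%N%:R * eta ^- tau i.

(** Expected payment between the first visits to [b + i] and [b + i.+1].  The walk
    pays at [b + i]; with probability [1 - a] it steps left and has to come back
    first, at the expected price of the previous increment.  Solving this
    for the [i]-th increment gives the recursion, since [a^-1 = 1 + rho]. *)
Definition increment : nat -> R :=
  affine_rec rho (fun i => source_weight i * (1 + rho i)).

Definition potential (i : nat) : R := \sum_(i <= x < N) increment x.

(** Nothing is paid to the left of [b], so that the expected payment is constant
    there. *)
Definition lyapunov (y : int) : R :=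
  if y - b is Posz i then potential i else potential 0.

Let src_ge0 i : 0 <= source_weight i.
Proof. by rewrite mulr_ge0 ?ler0n// invr_ge0 exprn_ge0// ltW. Qed.

Let incr_ge0 i : 0 <= increment i.
Proof. by apply: affine_rec_ge0 => // j; rewrite mulr_ge0// addr_ge0. Qed.

Lemma lyapunovE (i : nat) : lyapunov (b + i%:Z) = potential i.
Proof. by rewrite /lyapunov addrAC subrr add0r. Qed.

Lemma lyapunov_left (y : int) : y < b -> lyapunov y = potential 0.
Proof. by rewrite /lyapunov; case: (y - b) (subrK b y) => // n <-; lia. Qed.

Lemma potential_ge0 i : 0 <= potential i.
Proof. exact: sumr_ge0. Qed.

Lemma lyapunov_ge0 y : 0 <= lyapunov y.
Proof. by rewrite /lyapunov; case: (y - b) => i; exact: potential_ge0. Qed.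

Let potentialS i : (i < N)%N -> potential i = increment i + potential i.+1.
Proof. by move=> iN; rewrite /potential big_ltn. Qed.

Lemma lyapunov_drift (i : nat) : (i < N)%N ->
  nn_step a lyapunov (b + i%:Z) = potential i - source_weight i.
Proof.
move=> iN; rewrite /nn_step.
rewrite (_ : b + i%:Z + 1 = b + i.+1%:Z); last lia.
rewrite lyapunovE.
case: i iN => [|i] iN.
  rewrite lyapunov_left; last lia.
  rewrite (potentialS 0%N)// /increment /=.
  set u := source_weight 0; set v := potential 1.
  have := aD1rho 0; set z := rho 0 => h.
  apply: (@etrans _ _ (u * (1 + z) + v - a (b + 0%N%:Z) * (1 + z) * u)); first ring.
  by rewrite h mul1r.
rewrite (_ : b + i.+1%:Z - 1 = b + i%:Z); last lia.
rewrite lyapunovE (potentialS i (ltnW iN)) !(potentialS i.+1 iN).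
have -> : increment i.+1 = rho i.+1 * increment i + source_weight i.+1 * (1 + rho i.+1) by [].
set u := source_weight i.+1; set v := potential i.+2; set g := increment i.
have := aD1rho i.+1; set z := rho i.+1 => h.
apply: (@etrans _ _ (v + (g + u) * (1 + z) - a (b + i.+1%:Z) * (1 + z) * (g + u))).
  ring.
rewrite h mul1r; ring.
Qed.

Lemma lyapunov_left_drift (y : int) : y < b -> nn_step a lyapunov y = lyapunov y.
Proof.
move=> yb; rewrite /nn_step [lyapunov (y - 1)]lyapunov_left; last lia.
rewrite [in RHS]lyapunov_left//.
have -> : lyapunov (y + 1) = potential 0.
  have [yb1|yb1] := ltP (y + 1) b; first by rewrite lyapunov_left.
  by rewrite (_ : y + 1 = b + 0%N%:Z) ?lyapunovE//; lia.
ring.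
Qed.

Lemma source_le_potential i : (i < N)%N -> source_weight i <= potential i.
Proof.
move=> iN; rewrite potentialS// -[leLHS]addr0 lerD ?potential_ge0//.
apply: le_trans (affine_rec_ge _ _ _ _ _) => //.
- by rewrite ler_peMr// lerDl.
- by move=> j; rewrite mulr_ge0// addr_ge0.
Qed.

Let increment_le i : increment i <= w i * eta ^- tau i.
Proof.
have srcE j : source_weight j * (1 + rho j) =
    (j <= M)%N%:R * (1 + rho j) * eta ^- tau j.
  by rewrite /source_weight mulrAC.
elim: i => [|i IH]; first by rewrite [leRHS](esym (srcE 0%N)).
have -> : increment i.+1 = rho i.+1 * increment i + source_weight i.+1 * (1 + rho i.+1) by [].
have -> : w i.+1 = eta * rho i.+1 * w i + (i.+1 <= M)%N%:R * (1 + rho i.+1) by [].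
rewrite mulrDl srcE lerD2r [eta * _]mulrC -2!(mulrA (rho i.+1)).
rewrite ler_wpM2l// -mulrA (le_trans IH)// mulrCA ler_wpM2l// -ler_pdivrMl//.
rewrite -invfM -exprS lef_pV2 ?posrE ?exprn_gt0//.
by rewrite ler_weXn2l// ltW.
Qed.

(** The 1-Lipschitz condition gives [increment x <= w x * eta ^- tau x], and
    monotonicity replaces [tau x] by the smaller [tau i] for [i <= x]. *)
Lemma potential_le i : (i < N)%N -> potential i <= A * eta ^- tau i.
Proof.
move=> iN; rewrite /potential /A /total_cost -/w.
rewrite (@big_cat_nat _ _ _ i 0%N N)//=; last exact: ltnW.
rewrite mulrDl ler_wpDl//; first by rewrite mulr_ge0 ?sumr_ge0 ?invr_ge0 ?exprn_ge0// ltW.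
rewrite mulr_suml big_nat_cond [leRHS]big_nat_cond; apply: ler_sum => j /andP[/andP[ij _] _].
apply: (le_trans (increment_le j)); apply: ler_wpM2l => //.
by rewrite lef_pV2 ?posrE ?exprn_gt0// ler_weXn2l ?(ltW eta1)// tau_nd.
Qed.

End weight.
End lyapunov.

(** Start at [b + L] and let the walk pay on the sites up to [b + 3 L].  With
    [psi1] for [tau i = i] and [psi2] for [tau i = i - 2 L], one step of the
    walk shrinks [psi2] by the factor [1 - A^-1], up to errors in two places:
    to the right of [b + 3 L], where [psi2] is at most [A * eta ^- L], and to
    the left of [b], where [psi1 >= 1] dominates it.  As [psi1] is superharmonic and
    small at the starting point, these errors stay small over [n] steps.  The sum
    defining [psi2] stops at [N], hence the restriction to points that cannot
    reach [b + N] in the remaining time. *)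
Lemma slow_walk_bound {R : realType} (a : int -> R) (b : int) (eta A : R) (L N n : nat) :
  (forall y, 0 < a y < 1) -> 1 < eta -> (2 * L < N)%N -> (L + n < N)%N ->
  total_cost (env_ratio a b) eta (3 * L) N = A ->
  iter n (nn_step a) (\1_[set y | y <= b + (2 * L)%N%:Z]) (b + L%:Z) <=
  A * (1 - A^-1) ^+ n + n%:R * ((1 + A) * eta ^- L).
Proof.
move=> a01 eta1 L2N LnN AE.
have a01' y : 0 <= a y <= 1 by have /andP[? ?] := a01 y; apply/andP; split; apply: ltW.
have eta0 : 0 < eta by apply: lt_trans eta1.
have N0 : (0 < N)%N by apply: leq_ltn_trans LnN.
have A1 : 1 <= A by rewrite -AE; apply: total_cost_ge1.
have A0 : 0 < A by apply: lt_le_trans A1.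
pose tau2 i := (i - 2 * L)%N.
pose pot1 := potential a b eta (3 * L) N id.
pose pot2 := potential a b eta (3 * L) N tau2.
pose psi1 := lyapunov a b eta (3 * L) N id.
pose psi2 := lyapunov a b eta (3 * L) N tau2.
have nd2 i j : (i <= j)%N -> (tau2 i <= tau2 j)%N by rewrite /tau2; lia.
have lip2 i : (tau2 i.+1 <= (tau2 i).+1)%N by rewrite /tau2; lia.
have psi1E i : psi1 (b + i%:Z) = pot1 i by exact: lyapunovE.
have psi2E i : psi2 (b + i%:Z) = pot2 i by exact: lyapunovE.
have psi1_ge0 y : 0 <= psi1 y by apply: lyapunov_ge0.
have psi2_ge0 y : 0 <= psi2 y by apply: lyapunov_ge0.
have pot1_le i : (i < N)%N -> pot1 i <= A * eta ^- i.
  by move=> iN; rewrite -AE; apply: (@potential_le _ a b eta (3 * L) N _ _ id).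
have pot2_le i : (i < N)%N -> pot2 i <= A * eta ^- tau2 i.
  by move=> iN; rewrite -AE; apply: potential_le.
have src i tau : (i < N)%N -> source_weight eta (3 * L) tau i <= potential a b eta (3 * L) N tau i.
  exact: source_le_potential.
have src1 i tau : (i <= 3 * L)%N -> tau i = 0%N -> source_weight eta (3 * L) tau i = 1.
  by rewrite /source_weight => -> ->; rewrite expr0 invr1 mulr1.
have psi1_left y : y < b -> 1 <= psi1 y.
  by move=> yb; rewrite /psi1 lyapunov_left// (le_trans _ (src _ _ N0))// src1.
have psi2_one y : y <= b + (2 * L)%N%:Z -> 1 <= psi2 y.
  move=> y2L; have [yb|yb] := ltP y b.
    by rewrite /psi2 lyapunov_left// (le_trans _ (src _ _ N0))// src1.
  have [i yi] : exists i : nat, y = b + i%:Z by exists `|y - b|%N; lia.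
  have iN : (i < N)%N by lia.
  by rewrite yi psi2E (le_trans _ (src _ _ iN))// src1 ?/tau2//; lia.
have drift1 y : y < b + N%:Z -> nn_step a psi1 y <= psi1 y.
  move=> yN; have [yb|yb] := ltP y b; first by rewrite /psi1 lyapunov_left_drift.
  have [i yi] : exists i : nat, y = b + i%:Z by exists `|y - b|%N; lia.
  rewrite yi /psi1 lyapunov_drift//; last by lia.
  by rewrite lyapunovE gerBl mulr_ge0// invr_ge0 exprn_ge0// ltW.
have drift2 y : y < b + N%:Z ->
    nn_step a psi2 y <= (1 - A^-1) * psi2 y + (eta ^- L + psi1 y).
  move=> yN; rewrite mulrBl mul1r -addrA; have [yb|yb] := ltP y b.
    rewrite /psi2 lyapunov_left_drift// lerDl -/psi2.
    rewrite addrC subr_ge0 (@le_trans _ _ 1)//.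
      rewrite mulrC ler_pdivrMr// mul1r /psi2 lyapunov_left//.
      rewrite (le_trans (pot2_le _ N0))// ger_pMr// invf_le1 ?exprn_gt0//.
    by rewrite (le_trans (psi1_left _ yb))// lerDr invr_ge0 exprn_ge0// ltW.
  have [i yi] : exists i : nat, y = b + i%:Z by exists `|y - b|%N; lia.
  have iN : (i < N)%N by lia.
  rewrite yi {1}/psi2 lyapunov_drift// psi2E -/pot2 lerD2l.
  have [i3|i3] := leqP i (3 * L).
    rewrite -[leLHS]addr0 lerD ?addr_ge0 ?invr_ge0 ?exprn_ge0 ?(ltW eta0)//.
    rewrite lerN2 mulrC ler_pdivrMr// /source_weight i3 mul1r mulrC.
    exact: pot2_le.
  rewrite {1}/source_weight leqNgt i3 /= mul0r oppr0 addrC subr_ge0.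
  rewrite -[leLHS]addr0 lerD// mulrC ler_pdivrMr// mulrC.
  rewrite (le_trans (pot2_le _ iN))// ler_wpM2l ?(ltW A0)//.
  by rewrite lef_pV2 ?posrE ?exprn_gt0// ler_weXn2l ?(ltW eta1)// /tau2; lia.
have Ainv : 0 <= 1 - A^-1 <= 1.
  by rewrite subr_ge0 invf_le1// A1 gerBl invr_ge0 ltW.
have main j : forall y, y + j%:Z < b + N%:Z -> iter j (nn_step a) psi2 y <=
    (1 - A^-1) ^+ j * psi2 y + j%:R * (eta ^- L + psi1 y).
  elim: j => [|j IH] y yjN; first by rewrite mul1r mul0r addr0.
  have yN : y < b + N%:Z by lia.
  rewrite iterS.
  pose v z := (1 - A^-1) ^+ j * psi2 z + j%:R * (eta ^- L + psi1 z).
  apply: (@le_trans _ _ (nn_step a v y)).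
    by apply: nn_step_mono => //; apply: IH; lia.
  have -> : nn_step a v y = (1 - A^-1) ^+ j * nn_step a psi2 y +
      j%:R * (eta ^- L + nn_step a psi1 y) by rewrite /nn_step /v; ring.
  have j0 : 0 <= j%:R :> R by apply: ler0n.
  have Aj0 : 0 <= (1 - A^-1) ^+ j by rewrite exprn_ge0//; case/andP: Ainv.
  have Aj1 : (1 - A^-1) ^+ j <= 1 by rewrite exprn_ile1//; case/andP: Ainv.
  have h1 := ler_wpM2l Aj0 (drift2 _ yN).
  have h2 := ler_wpM2l j0 (drift1 _ yN).
  have e0 : 0 <= eta ^- L + psi1 y by rewrite addr_ge0// invr_ge0 exprn_ge0// ltW.
  have h3 := ler_wpM2r e0 Aj1.
  rewrite exprSr -natr1; move: h1 h2 h3; rewrite !mulrDr !mulrDl !mul1r => h1 h2 h3.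
  lra.
apply: le_trans (iter_nn_step_mono a _ psi2 _ a01' _ _) _.
  move=> y; rewrite indicE; case: (boolP (y \in _)) => [|_]; last exact: psi2_ge0.
  by rewrite inE /= => /psi2_one.
apply: le_trans (main n _ _) _; first by lia.
have LN : (L < N)%N by lia.
have p1 := pot1_le _ LN.
have p2 := pot2_le _ LN.
rewrite psi1E psi2E lerD//.
  rewrite mulrC ler_wpM2r ?exprn_ge0//; first by case/andP: Ainv.
  by rewrite (le_trans p2)// (_ : tau2 L = 0)%N ?expr0 ?invr1 ?mulr1// /tau2; lia.
by rewrite ler_wpM2l// mulrDl mul1r lerD2l.
Qed.

(** * Fractional powers of the total cost *)

(** With [t = x + y], each of [x / t] and [y / t] is at most its power [s], and the
    two ratios add up to one. *)
Lemma powR_subadditive {R : realType} (x y s : R) : 0 <= x -> 0 <= y -> 0 < s <= 1 ->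
  (x + y) `^ s <= x `^ s + y `^ s.
Proof.
move=> x0 y0 /andP[s0 s1].
have [t0|t0] := eqVneq (x + y) 0.
  by rewrite t0 powR0 ?gt_eqF// addr_ge0 ?powR_ge0.
have {t0}t0 : 0 < x + y by rewrite lt_neqAle eq_sym t0 addr_ge0.
have part z : 0 <= z <= x + y -> z / (x + y) * (x + y) `^ s <= z `^ s.
  move=> /andP[z0 zt]; have [->|zn0] := eqVneq z 0; first by rewrite !mul0r powR_ge0.
  rewrite -[z in leRHS](divfK (lt0r_neq0 t0)) powRM ?divr_ge0 ?(ltW t0)//.
  rewrite ler_wpM2r ?powR_ge0//; apply: ger1_powR => //.
  have zp : 0 < z by rewrite lt_neqAle eq_sym zn0.
  by rewrite divr_gt0//= ler_pdivrMr// mul1r.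
have := lerD (part x _) (part y _); rewrite -mulrDl -mulrDl divff ?lt0r_neq0// mul1r.
by apply; rewrite ?x0 ?y0 ?lerDl ?lerDr.
Qed.

Lemma total_cost_powR {R : realType} (rho : nat -> R) (eta s : R) (M N : nat) :
  (forall i, 0 <= rho i) -> 0 <= eta -> 0 < s <= 1 ->
  total_cost rho eta M N `^ s <= total_cost (fun i => rho i `^ s) (eta `^ s) M N.
Proof.
move=> rho0 eta0 s01; have /andP[s0 s1] := s01.
have src i : ((i <= M)%N%:R * (1 + rho i)) `^ s <= (i <= M)%N%:R * (1 + rho i `^ s).
  case: (i <= M)%N; last by rewrite !mul0r powR0 ?gt_eqF.
  by rewrite !mul1r (le_trans (powR_subadditive _ _ _ _ _ s01))// powR1.
have w0 x : 0 <= affine_rec (fun i => eta * rho i) (fun i => (i <= M)%N%:R * (1 + rho i)) x.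
  by apply: affine_rec_ge0 => i; rewrite mulr_ge0 ?ler0n ?addr_ge0.
have rec x : affine_rec (fun i => eta * rho i) (fun i => (i <= M)%N%:R * (1 + rho i)) x `^ s <=
    affine_rec (fun i => eta `^ s * rho i `^ s) (fun i => (i <= M)%N%:R * (1 + rho i `^ s)) x.
  elim: x => [|x IH]; first exact: src.
  rewrite [X in X `^ s <= _]/= [leRHS]/=.
  apply: (le_trans (powR_subadditive _ _ _ _ _ s01)).
  - by rewrite mulr_ge0 ?w0// mulr_ge0.
  - by rewrite mulr_ge0 ?ler0n ?addr_ge0.
  apply: lerD; last exact: src.
  rewrite powRM; [|by rewrite mulr_ge0|exact: w0].
  by rewrite powRM// ler_wpM2l// mulr_ge0 ?powR_ge0.
rewrite /total_cost; elim: N => [|N IH].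
  by rewrite !big_geq// powR0 ?gt_eqF.
rewrite !big_nat_recr//= (le_trans (powR_subadditive _ _ _ _ _ s01))//.
- by apply: sumr_ge0 => i _; exact: w0.
- by apply: lerD.
Qed.

(** Unfolding the recursion: the contribution of the source at [y] is multiplied
    by all the later coefficients.  In this form every factor depends on a
    different site, so that expectations can be taken factor by factor. *)
Lemma affine_rec_prod {R : realType} (f : nat -> R) (c : R) (M x : nat) :
  affine_rec (fun i => c * f i) (fun i => (i <= M)%N%:R * (1 + f i)) x =
  \sum_(y < x.+1) (y <= M)%N%:R *
    \prod_(i <- index_iota y x.+1) (if i == y then 1 + f i else c * f i).
Proof.
elim: x => [|x IH].
  by rewrite big_ord1 /index_iota /= big_seq1 eqxx.
rewrite [LHS]/= IH [in RHS]big_ord_recr mulr_sumr; congr (_ + _).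
  apply: eq_bigr => y _; rewrite [in RHS]big_nat_recr/=; last exact: ltnW.
  by rewrite gtn_eqF// mulrCA [X in _ = _ * X]mulrC.
by rewrite big_nat1 eqxx.
Qed.

(** Summing the recursion [m_(x+1) = c r m_x + source] over [x] gives
    [(1 - c r) * sum <= total source], and only [M.+1] sources are nonzero. *)
Lemma total_cost_cst_le {R : realType} (r c : R) (M N : nat) :
  0 <= r -> 0 <= c -> c * r < 1 ->
  total_cost (fun=> r) c M N <= M.+1%:R * ((1 + r) / (1 - c * r)).
Proof.
move=> r0 c0 q1.
pose m := affine_rec (fun=> c * r) (fun i => (i <= M)%N%:R * (1 + r)).
have m0 x : 0 <= m x by apply: affine_rec_ge0 => i; rewrite mulr_ge0// ?ler0n ?addr_ge0.
have src n : \sum_(0 <= x < n) (x <= M)%N%:R <= M.+1%:R :> R.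
  rewrite -natr_sum ler_nat (_ : (\sum_(0 <= x < n) (x <= M) = minn n M.+1)%N) ?geq_minr//.
  elim: n => [|n IH]; first by rewrite big_geq// min0n.
  by rewrite big_nat_recr//= IH; lia.
have key n : (1 - c * r) * \sum_(0 <= x < n.+1) m x + c * r * m n =
    (\sum_(0 <= x < n.+1) (x <= M)%N%:R) * (1 + r).
  elim: n => [|n IH]; first by rewrite !big_nat1 /m /=; ring.
  rewrite big_nat_recr//= [in RHS]big_nat_recr//= [in RHS]mulrDl -IH.
  have -> : m n.+1 = c * r * m n + (n.+1 <= M)%N%:R * (1 + r) by [].
  ring.
rewrite /total_cost -/m mulrA ler_pdivlMr ?subr_gt0//.
case: N => [|n]; first by rewrite big_geq// mul0r mulr_ge0 ?addr_ge0.
apply: (@le_trans _ _ ((\sum_(0 <= x < n.+1) (x <= M)%N%:R) * (1 + r))).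
  by rewrite -key mulrC lerDl !mulr_ge0.
by rewrite ler_wpM2r ?addr_ge0.
Qed.

(** * Expectation of a product of independent variables *)

Section independence_extension.
Context {d d'} {T : measurableType d} {U : measurableType d'} {R : realType}.
Variable P : {measure set T -> \bar R}.
Import HBNNSimple.
Local Open Scope ereal_scope.

(** From indicators to nonnegative functions of [X], by approximation with simple
    functions and monotone convergence. *)
Lemma factorization_extends (X : {mfun T >-> U}) (Y : T -> R) (C : R) :
  measurable_fun [set: T] Y -> (forall w, (0 <= Y w)%R) -> (0 <= C)%R ->
  (forall B : set U, measurable B ->
     \int[P]_w (\1_B (X w) * Y w)%:E = C%:E * P (X @^-1` B)) ->
  forall g : U -> R, measurable_fun [set: U] g -> (forall y, (0 <= g y)%R) ->
  \int[P]_w (g (X w) * Y w)%:E = C%:E * \int[P]_w (g (X w))%:E.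
Proof.
move=> mY Y0 C0 hB g mg g0.
have meg : measurable_fun [set: U] (fun y => (g y)%:E) by exact/measurable_EFinP.
pose g_ := nnsfun_approx measurableT meg.
have g_cvg y : (g_ n y)%:E @[n --> \oo] --> (g y)%:E.
  by apply: cvg_nnsfun_approx => // z _; rewrite lee_fin.
have g_nd y m n : (m <= n)%N -> (g_ m y <= g_ n y)%R.
  by move=> mn; exact/lefP/nd_nnsfun_approx.
have g_ge0 n y : (0 <= g_ n y)%R by [].
have mgX n : measurable_fun [set: T] (fun w => g_ n (X w)).
  by apply: measurableT_comp => //; exact: measurable_funP.
have step n : \int[P]_w (g_ n (X w) * Y w)%:E = C%:E * \int[P]_w (g_ n (X w))%:E.
  have mind r : measurable_fun [set: T] (fun w => \1_(g_ n @^-1` [set r]) (X w) : R).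
    by apply: measurableT_comp => //; apply: measurable_indic; exact: measurable_funPTI.
  have range0 (i : 'I_(size (fset_set (g_ n @` setT)))) :
      (0 <= (fset_set (g_ n @` setT))`_i)%R.
    have := mem_nth 0%R (ltn_ord i); rewrite in_fset_set// => /set_mem[y _ <-].
    exact: g_ge0.
  under eq_integral do rewrite fimfunEord mulr_suml -sumEFin.
  rewrite ge0_integral_sum//; last 2 first.
  - move=> i; apply/measurable_EFinP; apply: measurable_funM => //.
    exact: measurable_funM.
  - by move=> i w _; rewrite lee_fin !mulr_ge0.
  under [in RHS]eq_integral do rewrite fimfunEord -sumEFin.
  rewrite ge0_integral_sum//; last 2 first.
  - by move=> i; apply/measurable_EFinP; apply: measurable_funM.
  - by move=> i w _; rewrite lee_fin !mulr_ge0.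
  rewrite ge0_sume_distrr; last first.
    by move=> i _; apply: integral_ge0 => w _; rewrite lee_fin mulr_ge0.
  apply: eq_bigr => i _.
  under eq_integral do rewrite -mulrA EFinM.
  rewrite ge0_integralZl_EFin//; last 2 first.
  - by move=> w _; rewrite lee_fin mulr_ge0.
  - by apply/measurable_EFinP; apply: measurable_funM.
  under [in RHS]eq_integral do rewrite EFinM.
  rewrite [in RHS]ge0_integralZl_EFin//; last first.
    exact/measurable_EFinP.
  rewrite hB; last exact: measurable_funPTI.
  rewrite muleCA; congr (_ * (_ * _)).
  rewrite -[RHS]/(\int[P]_w (\1_(X @^-1` (g_ n @^-1` [set (fset_set (g_ n @` setT))`_i])) w)%:E).
  by rewrite integral_indic ?setIT//; apply: measurable_funPTI; exact: measurable_funPTI.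
have E1 : \int[P]_w (g (X w) * Y w)%:E = limn (fun n => \int[P]_w (g_ n (X w) * Y w)%:E).
  rewrite -monotone_convergence//.
  - apply: eq_integral => w _; apply/esym/cvg_lim => //.
    under eq_fun do rewrite EFinM.
    by rewrite EFinM; apply: cvgeZr.
  - by move=> n; apply/measurable_EFinP; exact: measurable_funM.
  - by move=> n w _; rewrite lee_fin mulr_ge0.
  - by move=> w _ m n mn; rewrite lee_fin ler_wpM2r// g_nd.
have E2 : \int[P]_w (g_ n (X w))%:E @[n --> \oo] --> \int[P]_w (g (X w))%:E.
  rewrite [X in _ --> X](_ : _ = \int[P]_w limn (fun n => (g_ n (X w))%:E)).
    apply: cvg_monotone_convergence => //.
    - by move=> n; exact/measurable_EFinP.
    - by move=> n w _; rewrite lee_fin.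
    - by move=> w _ m n mn; rewrite lee_fin g_nd.
  by apply: eq_integral => w _; apply/esym/cvg_lim.
rewrite E1; under eq_fun do rewrite step.
by apply/cvg_lim => //; exact: cvgeZl.
Qed.

End independence_extension.

(** Independence is the product rule for indicators.  The indicators are replaced
    by general functions one at a time: the claim is proved for a product of
    functions over [J1] times an indicator of an event of the
    remaining variables [J2], by induction on [J1]. *)
Lemma expectation_prod_indep {d d'} {T : measurableType d} {U : measurableType d'}
    {R : realType} (P : probability T R) {I : choiceType} (X : I -> {mfun T >-> U})
    (g : I -> U -> R) (m : I -> R) (J : seq I) :
  mutual_independence P (fun i => sigma_rv (X i)) ->
  (forall i, measurable_fun [set: U] (g i)) -> (forall i y, 0 <= g i y) ->
  (forall i, (\int[P]_w (g i (X i w))%:E = (m i)%:E)%E) -> uniq J ->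
  (\int[P]_w (\prod_(i <- J) g i (X i w))%:E = (\prod_(i <- J) m i)%:E)%E.
Proof.
move=> indep mg g0 gm uJ.
pose E (J2 : seq I) (A : I -> set U) := \bigcap_(i in [set` J2]) (X i @^-1` A i).
have mX i A : measurable A -> measurable (X i @^-1` A) by move=> ?; exact: measurable_funPTI.
have mE J2 A : (forall i, measurable (A i)) -> measurable (E J2 A).
  by move=> mA; apply: fin_bigcap_measurable => // i _; exact: mX.
have EP J2 A : uniq J2 -> (forall i, measurable (A i)) ->
    P (E J2 A) = (\prod_(i <- J2) P (X i @^-1` A i))%E.
  move=> uJ2 mA; apply: indep => // i _.
  by exists (A i) => //; rewrite setTI.
have m0 i : 0 <= m i.
  by rewrite -lee_fin -gm integral_ge0// => w _; rewrite lee_fin.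
suff claim J1 : forall J2 A, uniq (J1 ++ J2) -> (forall i, measurable (A i)) ->
    (\int[P]_w (\prod_(i <- J1) g i (X i w) * \1_(E J2 A) w)%:E =
     (\prod_(i <- J1) m i)%:E * P (E J2 A))%E.
  have := claim J [::] (fun=> setT); rewrite cats0 => /(_ uJ (fun=> measurableT)).
  have -> : E [::] (fun=> setT) = setT by apply/seteqP; split => // t _ i.
  rewrite probability_setT mule1 => <-.
  by apply: eq_integral => w _; rewrite indicE in_setT mulr1.
elim: J1 => [|i J1 IH] J2 A uJ12 mA.
  rewrite big_nil mul1e.
  under eq_integral do rewrite big_nil mul1r.
  by rewrite integral_indic ?setIT//; exact: mE.
move: uJ12; rewrite cat_cons cons_uniq mem_cat negb_or => /andP[/andP[iJ1 iJ2] uJ12].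
have uJ2 : uniq J2 by move: uJ12; rewrite cat_uniq => /and3P[].
have P_fin : P (E J2 A) = (fine (P (E J2 A)))%:E.
  by rewrite fineK// fin_num_measure//; exact: mE.
pose Y w := \prod_(i <- J1) g i (X i w) * \1_(E J2 A) w.
rewrite big_cons EFinM -muleA muleC P_fin -EFinM EFinM -gm.
rewrite -(@factorization_extends _ _ _ _ _ P (X i) Y).
- by apply: eq_integral => w _; rewrite big_cons -mulrA.
- apply: measurable_funM; last by apply: measurable_indic; exact: mE.
  apply: measurable_prod => j _; apply: measurableT_comp => //.
- by move=> w; rewrite mulr_ge0// prodr_ge0// => j _; exact: g0.
- by rewrite mulr_ge0 ?fine_ge0// prodr_ge0.
- move=> B mB; pose A' j := if j == i then B else A j.
  have mA' j : measurable (A' j) by rewrite /A'; case: ifP.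
  have uiJ2 : uniq (J1 ++ i :: J2).
    by move: uJ12; rewrite !cat_uniq /= (negbTE iJ1) iJ2 => /and3P[-> -> ->].
  have E' : E (i :: J2) A' = (X i @^-1` B) `&` E J2 A.
    have A'J2 j : j \in J2 -> A' j = A j.
      by rewrite /A'; case: eqP => // -> iJ2'; move: iJ2; rewrite iJ2'.
    apply/seteqP; split => [w h|w [hi h] j /=].
      split; first by have := h i (mem_head _ _); rewrite /A' eqxx.
      move=> j jJ2; rewrite -A'J2//; apply: h.
      by rewrite /= inE; apply/orP; right.
    by rewrite inE /A'; case: eqP => [-> _//|_ /= jJ2]; exact: h.
  have PE' : P (E (i :: J2) A') = (P (E J2 A) * P (X i @^-1` B))%E.
    rewrite !EP// ?cons_uniq ?iJ2// big_cons {1}/A' eqxx muleC; congr (_ * _)%E.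
    apply: eq_big_seq => j jJ2; rewrite /A'; case: eqP => // ji.
    by move: iJ2; rewrite -ji jJ2.
  rewrite EFinM -P_fin -muleA -PE' -IH//; apply: eq_integral => w _.
  rewrite /Y mulrCA E'; congr ((_ * _)%:E).
  by rewrite indicI.
- exact: mg.
- exact: g0.
Qed.

(** * Moments of the environment *)

(** The power [s] of the ratio [(1 - o) / o], written for [0 < o < 1] in a form whose
    measurability on the whole line is immediate. *)
Definition tilt {R : realType} (s o : R) : R := expR (s * (ln (1 - o) - ln o)).

Lemma powR_ratio {R : realType} (s o : R) : 0 < o < 1 -> ((1 - o) / o) `^ s = tilt s o.
Proof.
move=> /andP[lo hi]; have hi' : 0 < 1 - o by rewrite subr_gt0.
by rewrite /powR gt_eqF ?divr_gt0// ln_div.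
Qed.

Lemma measurable_tilt {R : realType} (s : R) : measurable_fun [set: R] (tilt s).
Proof.
apply: measurableT_comp; first exact: measurable_expR.
apply: measurable_funM => //; apply: measurable_funB; last exact: measurable_ln.
by apply: measurableT_comp; [exact: measurable_ln|exact: measurable_funB].
Qed.

Section environment.
Context {d} {W : measurableType d} {R : realType} (P : probability W R).
Variable omega : int -> {RV P >-> R}.
Hypothesis omega01 : forall x w, 0 < omega x w < 1.
Hypothesis omega_iid : iid omega.

Lemma rho_powE s x w : rho omega x w `^ s = tilt s (omega x w).
Proof. exact: powR_ratio. Qed.

Lemma rho_gt0 x w : 0 < rho omega x w.
Proof. by have /andP[? ?] := omega01 x w; rewrite /rho divr_gt0// subr_gt0. Qed.

Lemma measurable_rho_pow s x : measurable_fun [set: W] (fun w => rho omega x w `^ s).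
Proof.
under eq_fun do rewrite rho_powE.
by apply: measurableT_comp => //; exact: measurable_tilt.
Qed.

Lemma rho_moment_stationary s x :
  (\int[P]_w (rho omega x w `^ s)%:E = \int[P]_w (rho omega 0 w `^ s)%:E)%E.
Proof.
have E y : (\int[P]_w (rho omega y w `^ s)%:E =
            \int[distribution P (omega y)]_o (tilt s o)%:E)%E.
  rewrite ge0_integral_distribution.
  - by apply: eq_integral => w _; rewrite rho_powE.
  - by apply/measurable_EFinP; exact: measurable_tilt.
  - by move=> o; rewrite lee_fin expR_ge0.
rewrite !E; apply: eq_measure_integral => A mA _.
by case: omega_iid => _; exact.
Qed.

(** After expansion into products of functions of distinct sites, taking
    expectations replaces each [rho `^ s] by its mean [r]; folding the expansion
    back gives the total cost of a constant environment. *)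
Lemma total_cost_expectation (s r c : R) (b : int) (M N : nat) :
  0 <= c -> (\int[P]_w (rho omega 0 w `^ s)%:E = r%:E)%E ->
  (\int[P]_w (total_cost (fun i => rho omega (b + i%:Z) w `^ s) c M N)%:E =
   (total_cost (fun=> r) c M N)%:E)%E.
Proof.
move=> c0 rE; have [indep _] := omega_iid.
pose F (y x : nat) w := \prod_(i <- index_iota y x)
  (if i == y then 1 + rho omega (b + i%:Z) w `^ s else c * rho omega (b + i%:Z) w `^ s).
have pow0 x w : 0 <= rho omega x w `^ s by rewrite powR_ge0.
have F0 y x w : 0 <= F y x w.
  by apply: prodr_ge0 => i _; case: ifP => _; rewrite ?addr_ge0 ?mulr_ge0.
have mF y x : measurable_fun [set: W] (F y x).
  apply: measurable_prod => i _; case: (i == y).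
    by apply: measurable_funD => //; exact: measurable_rho_pow.
  by apply: measurable_funM => //; exact: measurable_rho_pow.
have FE y x : (\int[P]_w (F y x w)%:E =
    (\prod_(i <- index_iota y x) (if i == y then 1 + r else c * r))%:E)%E.
  pose g (j : int) (o : R) := if j == b + y%:Z then 1 + tilt s o else c * tilt s o.
  pose m (j : int) := if j == b + y%:Z then 1 + r else c * r.
  have tilt0 o : 0 <= tilt s o by exact: expR_ge0.
  have jE (i : nat) : (b + i%:Z == b + y%:Z) = (i == y) by rewrite (inj_eq (addrI _)).
  have tiltE j : (\int[P]_w (tilt s (omega j w))%:E = r%:E)%E.
    by rewrite -rE -(rho_moment_stationary s j); apply: eq_integral => w _; rewrite rho_powE.
  have mt j : measurable_fun [set: W] (fun w => tilt s (omega j w)).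
    by apply: measurableT_comp => //; exact: measurable_tilt.
  have gm j : (\int[P]_w (g j (omega j w))%:E = (m j)%:E)%E.
    rewrite /g /m; case: (j == _).
      under eq_integral do rewrite EFinD.
      rewrite ge0_integralD//; last 2 first.
        by move=> w _; rewrite lee_fin.
        exact/measurable_EFinP.
      rewrite tiltE integral_cst//= mul1e EFinD; congr (_ + _)%E.
      exact: probability_setT.
    under eq_integral do rewrite EFinM.
    rewrite ge0_integralZl_EFin//; last exact/measurable_EFinP.
      by rewrite tiltE EFinM.
    by move=> w _; rewrite lee_fin.
  have := @expectation_prod_indep _ _ _ _ _ P _ omega g m
    [seq b + i%:Z | i <- index_iota y x] indep.
  rewrite (_ : \prod_(j <- _) m j = \prod_(i <- index_iota y x) (if i == y then 1 + r else c * r)).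
    move=> <-//.
    - apply: eq_integral => w _; rewrite big_map; congr EFin.
      by apply: eq_bigr => i _; rewrite /g jE !rho_powE.
    - move=> j; rewrite /g; case: (j == _).
        by apply: measurable_funD => //; exact: measurable_tilt.
      by apply: measurable_funM => //; exact: measurable_tilt.
    - by move=> j o; rewrite /g; case: ifP => _; rewrite ?addr_ge0 ?mulr_ge0.
    - by rewrite map_inj_uniq ?iota_uniq// => i j /addrI[].
  by rewrite big_map; apply: eq_bigr => i _; rewrite /m jE.
have totE (f : nat -> R) : total_cost f c M N =
    \sum_(x <- index_iota 0 N) \sum_(y < x.+1) (y <= M)%N%:R *
      \prod_(i <- index_iota y x.+1) (if i == y then 1 + f i else c * f i).
  by apply: eq_bigr => x _; rewrite affine_rec_prod.
rewrite totE; under eq_integral do rewrite totE -sumEFin.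
rewrite ge0_integral_sum//; last 2 first.
- move=> x; apply/measurable_EFinP; apply: measurable_sum => y.
  by apply: measurable_funM => //; exact: (mF y x.+1).
- by move=> x w _; rewrite lee_fin sumr_ge0// => y _; rewrite mulr_ge0 ?ler0n//; exact: F0.
rewrite -sumEFin; apply: eq_bigr => x _.
under eq_integral do rewrite -sumEFin.
rewrite ge0_integral_sum//; last 2 first.
- move=> y; apply/measurable_EFinP.
  by apply: measurable_funM => //; exact: (mF y x.+1).
- by move=> y w _; rewrite lee_fin mulr_ge0 ?ler0n//; exact: F0.
rewrite -sumEFin; apply: eq_bigr => y _.
under eq_integral do rewrite EFinM.
rewrite ge0_integralZl_EFin ?ler0n//; last 2 first.
- by move=> w _; rewrite lee_fin; exact: F0.
- by apply/measurable_EFinP; exact: (mF y x.+1).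
by rewrite [X in (_ * X)%E = _](FE y x.+1) EFinM.
Qed.

End environment.

(** Strict convexity of the exponential: the chord between [0] and [v] lies above
    the tangent at [t * v], which is strictly below the graph at both ends. *)
Lemma expR_chord_lt {R : realType} (t v : R) : 0 < t < 1 -> v != 0 ->
  expR (t * v) < (1 - t) + t * expR v.
Proof.
move=> /andP[t0 t1] v0; have t1' : 0 < 1 - t by rewrite subr_gt0.
have e0 : 0 < expR (t * v) by exact: expR_gt0.
have h1 : 1 + (1 - t) * v < expR ((1 - t) * v).
  by apply: expR_gt1Dx; rewrite mulf_neq0// gt_eqF.
have h2 : 1 + (- (t * v)) < expR (- (t * v)).
  by apply: expR_gt1Dx; rewrite oppr_eq0 mulf_neq0// gt_eqF.
have k1 : t * (expR (t * v) * (1 + (1 - t) * v)) < t * expR v.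
  rewrite ltr_pM2l// (_ : v = t * v + (1 - t) * v); last by ring.
  rewrite [ltRHS]expRD -(_ : v = t * v + (1 - t) * v); last by ring.
  by rewrite ltr_pM2l.
have k2 : (1 - t) * (expR (t * v) * (1 + - (t * v))) < 1 - t.
  by rewrite gtr_pMr// -[ltRHS](expRxMexpNx_1 (t * v)) ltr_pM2l.
have := ltrD k2 k1; apply: le_lt_trans; rewrite le_eqVlt; apply/orP; left.
by apply/eqP; ring.
Qed.

Section subcritical.
Context {d} {W : measurableType d} {R : realType} (P : probability W R).
Variable omega : int -> {RV P >-> R}.
Hypothesis omega01 : forall x w, 0 < omega x w < 1.

(** With [t = s / kappa], the chord inequality gives
    [rho `^ s <= 1 - t + t * rho `^ kappa], whose right-hand side has mean one.
    Equality of the means would force equality almost everywhere, hence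
    [rho = 1] almost everywhere, and [ln rho] would have mean zero. *)
Lemma subcritical_moment (kappa s : R) :
  ('E_P[fun w => ln (rho omega 0 w)%R] < 0)%E ->
  ('E_P[fun w => (rho omega 0 w `^ kappa)%R] = 1)%E ->
  0 < s < kappa ->
  exists r : R, 0 <= r < 1 /\ (\int[P]_w (rho omega 0 w `^ s)%:E = r%:E)%E.
Proof.
rewrite unlock => transient critical /andP[s0 sk].
have k0 : 0 < kappa by apply: lt_trans sk.
pose t := s / kappa.
have t01 : 0 < t < 1 by rewrite divr_gt0// ltr_pdivrMr// mul1r.
have [t0 t1] := andP t01.
pose v w := kappa * ln (rho omega 0 w).
have powE p w : rho omega 0 w `^ p = expR (p * ln (rho omega 0 w)).
  by rewrite /powR gt_eqF// rho_gt0.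
have sE w : rho omega 0 w `^ s = expR (t * v w).
  by rewrite powE /v mulrA divfK// gt_eqF.
pose gap w := (1 - t) + t * rho omega 0 w `^ kappa - rho omega 0 w `^ s.
have gap0 w : 0 <= gap w.
  rewrite subr_ge0 sE powE -/(v w); have [->|vn0] := eqVneq (v w) 0.
    by rewrite mulr0 expR0 mulr1 subrK.
  exact/ltW/expR_chord_lt.
have mpow p := measurable_rho_pow P omega omega01 p 0.
have mgap : measurable_fun [set: W] gap.
  apply: measurable_funB => //; apply: measurable_funD => //.
  exact: measurable_funM.
have pow0 p w : 0 <= rho omega 0 w `^ p by exact: powR_ge0.
have t1' : 0 <= 1 - t by rewrite subr_ge0 ltW.
have P1 : (\int[P]_(_ in [set: W]) (1 - t)%:E = (1 - t)%:E)%E.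
  by rewrite integral_cst//= [P _]probability_setT mule1.
have total : (\int[P]_w (rho omega 0 w `^ s)%:E + \int[P]_w (gap w)%:E = 1)%E.
  rewrite -ge0_integralD//; last 4 first.
  - by move=> w _; rewrite lee_fin.
  - exact/measurable_EFinP.
  - by move=> w _; rewrite lee_fin.
  - exact/measurable_EFinP.
  transitivity (\int[P]_w ((1 - t)%:E + t%:E * (rho omega 0 w `^ kappa)%:E))%E.
    by apply: eq_integral => w _; rewrite -EFinM -!EFinD /gap addrC subrK.
  rewrite ge0_integralD//; last 2 first.
  - by move=> w _; rewrite -EFinM lee_fin mulr_ge0// ltW.
  - by apply/measurable_EFinP; exact: measurable_funM.
  rewrite P1 ge0_integralZl_EFin//; last 3 first.
  - by move=> w _; rewrite lee_fin.
  - exact/measurable_EFinP.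
  - exact: ltW.
  by rewrite critical mule1 -EFinD subrK.
have lnrho w : ln (rho omega 0 w) = ln (1 - omega 0 w) - ln (omega 0 w).
  have /andP[lo hi] := omega01 0 w.
  by rewrite /rho ln_div// posrE// subr_gt0.
have mln : measurable_fun [set: W] (fun w => ln (rho omega 0 w)).
  under eq_fun do rewrite lnrho.
  apply: measurable_funB.
    apply: measurableT_comp; first exact: measurable_ln.
    exact: measurable_funB.
  by apply: measurableT_comp => //; exact: measurable_ln.
have pow_ge0 : (0 <= \int[P]_w (rho omega 0 w `^ s)%:E)%E.
  by apply: integral_ge0 => w _; rewrite lee_fin.
have gap_ge0 : (0 <= \int[P]_w (gap w)%:E)%E.
  by apply: integral_ge0 => w _; rewrite lee_fin.
have le1 : (\int[P]_w (rho omega 0 w `^ s)%:E <= 1)%E by rewrite -total leeDl.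
have fin : (\int[P]_w (rho omega 0 w `^ s)%:E)%E \is a fin_num.
  by rewrite ge0_fin_numE// (le_lt_trans le1)// ltey.
exists (fine (\int[P]_w (rho omega 0 w `^ s)%:E)); split; last by rewrite fineK.
rewrite fine_ge0//= -lte_fin fineK// lt_neqAle le1 andbT; apply/eqP => eq1.
have gap_int0 : (\int[P]_w (gap w)%:E = 0)%E.
  move: total; rewrite eq1; case: (\int[P]_w (gap w)%:E)%E => // g.
  by rewrite -EFinD => -[] h; congr EFin; lra.
have gap_ae : ae_eq P setT (EFin \o gap) (cst 0%E).
  apply/ae_eq_integral_abs => //; first exact/measurable_EFinP.
  by rewrite -[RHS]gap_int0; apply: eq_integral => w _; rewrite /= ger0_norm.
have : (\int[P]_w (ln (rho omega 0 w))%:E = \int[P]_w (cst 0%E w))%E.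
  apply: ae_eq_integral => //; first exact/measurable_EFinP.
  apply: filterS gap_ae => w /(_ I) [gw0] _; congr EFin; apply/eqP.
  have vw0 : v w = 0.
    apply/eqP; apply: contraT => vn0; have := expR_chord_lt _ _ t01 vn0.
    by rewrite -subr_gt0 -sE {1}/v -powE -/(gap w) gw0 ltxx.
  by move: vw0 => /eqP; rewrite /v mulf_eq0 gt_eqF.
by rewrite integral0 => ln0; move: transient; rewrite ln0 ltxx.
Qed.

End subcritical.

(** * Borel-Cantelli lemmas *)

Lemma borel_cantelli_geometric {d} {T : measurableType d} {R : realType}
    (mu : {measure set T -> \bar R}) (E : nat -> set T) (C q : R) :
  0 <= q < 1 -> (forall k, measurable (E k)) ->
  (\forall k \near \oo, (mu (E k) <= (C * q ^+ k)%:E)%E) ->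
  mu (lim_sup_set E) = 0%E.
Proof.
move=> /andP[q0 q1] mE [K _ EK].
have C0 : 0 <= C * q ^+ K by rewrite -lee_fin (le_trans _ (EK K _))/=.
have mF k : measurable (E (k + K)%N) by [].
have F0 : mu (lim_sup_set (fun k => E (k + K)%N)) = 0%E.
  apply: lim_sup_set_cvg0 => //.
  have S : (\sum_(n <oo) (C * q ^+ K * q ^+ n)%:E <= (C * q ^+ K / (1 - q))%:E)%E.
    apply: lime_le; first by apply: is_cvg_nneseries => n _ _; rewrite lee_fin mulr_ge0 ?exprn_ge0.
    near=> n; rewrite sumEFin lee_fin -big_distrr/= ler_wpM2l//.
    rewrite -[leRHS]mul1r ler_pdivlMr ?subr_gt0//.
    have := subrX1 q n; rewrite big_mkord => e.
    rewrite mulrC -opprB mulNr -e opprB gerBl exprn_ge0//.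
  apply: le_lt_trans (le_trans _ S) (ltey _).
  apply: lee_nneseries => // n _; apply: (le_trans (EK _ _)); rewrite /= ?leq_addl// lee_fin.
  by rewrite exprD mulrA mulrAC.
apply: subset_measure0 F0.
- by apply: bigcap_measurable => // k _; exact: bigcup_measurable.
- by apply: bigcap_measurable => // k _; exact: bigcup_measurable.
move=> t h n _; have [j /= nj Ej] := h (n + K)%N I.
exists (j - K)%N => /=; first by rewrite leq_subRL ?(leq_trans _ nj) ?leq_addl// addnC.
by rewrite subnK// (leq_trans _ nj) ?leq_addl.
Unshelve. all: by end_near. Qed.

(** The union of the events of a block has measure at most
    [2 ^ k * C * 4 ^ - k = C * 2 ^ - k]. *)
Lemma dyadic_borel_cantelli {d} {T : measurableType d} {R : realType}
    (mu : {measure set T -> \bar R}) (F : nat -> set T) (C : R) :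
  (forall n, measurable (F n)) ->
  (\forall k \near \oo, forall n, (2 ^ k <= n < 2 ^ k.+1)%N ->
     (mu (F n) <= (C * (4^-1) ^+ k)%:E)%E) ->
  mu (lim_sup_set F) = 0%E.
Proof.
move=> mF bound.
pose E k := \big[setU/set0]_(i < 2 ^ k) F (2 ^ k + i)%N.
have mE k : measurable (E k) by apply: bigsetU_measurable.
have E0 : mu (lim_sup_set E) = 0%E.
  apply: (@borel_cantelli_geometric _ _ _ _ _ C 2^-1) => //.
    by apply/andP; split; lra.
  near=> k.
  have bk : forall n, (2 ^ k <= n < 2 ^ k.+1)%N -> (mu (F n) <= (C * (4^-1) ^+ k)%:E)%E.
    by near: k.
  apply: (@le_trans _ _ (\sum_(i < 2 ^ k) mu (F (2 ^ k + i)%N))%E).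
    exact: (@Boole_inequality _ _ _ mu (fun i => F (2 ^ k + i)%N)).
  apply: (@le_trans _ _ (\sum_(i < 2 ^ k) (C * (4^-1) ^+ k)%:E)%E).
    apply: lee_sum => i _; apply: bk.
    by rewrite leq_addr expnS mul2n -addnn ltn_add2l ltn_ord.
  rewrite sumEFin lee_fin sumr_const card_ord -[leLHS]mulr_natl natrX mulrCA -exprMn.
  by rewrite (_ : 2 * 4^-1 = 2^-1)//; field.
have sub : lim_sup_set F `<=` lim_sup_set E.
  move=> t h K _; have [n /= Kn Fn] := h (2 ^ K)%N I.
  have n0 : (0 < n)%N by rewrite (leq_trans _ Kn)// expn_gt0.
  have /andP[lg1 lg2] := trunc_log_bounds (isT : (1 < 2)%N) n0.
  exists (trunc_log 2 n) => /=; first by rewrite trunc_log_max.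
  rewrite /E -(bigcup_mkord _ (fun i => F (2 ^ trunc_log 2 n + i)%N)).
  exists (n - 2 ^ trunc_log 2 n)%N => /=; last by rewrite subnKC.
  by rewrite ltn_subLR// addnn -mul2n -expnS.
apply: subset_measure0 E0 => //.
- by apply: bigcap_measurable => // k _; exact: bigcup_measurable.
- by apply: bigcap_measurable => // k _; exact: bigcup_measurable.
Unshelve. all: by end_near. Qed.

Lemma near_notin_lim_sup {T : Type} (F : nat -> set T) (t : T) :
  ~ lim_sup_set F t -> \forall n \near \oo, ~ F n t.
Proof.
move=> tF; apply: contrapT => nnear; apply: tF => K _; apply: contrapT => nF.
by apply: nnear; exists K => // n Kn Fn; apply: nF; exists n.
Qed.

(** * Almost sure growth of the total cost *)

Section environment_cost.
Context {d} {W : measurableType d} {R : realType} (P : probability W R).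
Variable omega : int -> {RV P >-> R}.
Hypothesis omega01 : forall x w, 0 < omega x w < 1.
Hypothesis omega_iid : iid omega.

Lemma measurable_total_cost (s c : R) (b : int) (M N : nat) :
  measurable_fun [set: W]
    (fun w => total_cost (fun i => rho omega (b + i%:Z) w `^ s) c M N).
Proof.
have mrho i := measurable_rho_pow P omega omega01 s (b + i%:Z).
apply: measurable_sum => x; elim: x => [|x IH] /=.
  by apply: measurable_funM => //; exact: measurable_funD.
apply: measurable_funD; last by apply: measurable_funM => //; exact: measurable_funD.
by apply: measurable_funM => //; exact: measurable_funM.
Qed.

(** Markov's inequality: the expectation is of order [alpha ^+ k], while the
    threshold is [beta ^+ k].  The endpoint [N k] may be arbitrary because the
    expectation is bounded uniformly in it. *)
Lemma total_cost_eventually_le (s r c alpha beta : R) (b : nat -> int) (N : nat -> nat) :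
  0 <= r -> (\int[P]_w (rho omega 0 w `^ s)%:E = r%:E)%E -> 0 <= c -> c * r < 1 ->
  1 < alpha < beta ->
  {ae P, forall w, \forall k \near \oo,
    total_cost (fun i => rho omega (b k + i%:Z) w `^ s) c
      (3 * Num.truncn (alpha ^+ k)) (N k) <= beta ^+ k}.
Proof.
move=> r0 rE c0 q1 /andP[a1 ab].
have a0 : 0 < alpha by apply: lt_trans a1.
have b0 : 0 < beta by apply: lt_trans ab.
pose K := (1 + r) / (1 - c * r).
have K0 : 0 <= K.
  by apply: divr_ge0; [exact: addr_ge0|rewrite subr_ge0; exact: ltW].
pose L k := Num.truncn (alpha ^+ k).
pose tc k w := total_cost (fun i => rho omega (b k + i%:Z) w `^ s) c (3 * L k) (N k).
have mtc k : measurable_fun [set: W] (tc k) by exact: measurable_total_cost.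
have tc0 k w : 0 <= tc k w.
  apply: sumr_ge0 => i _; apply: affine_rec_ge0 => j.
    by rewrite mulr_ge0 ?powR_ge0.
  by rewrite mulr_ge0 ?ler0n ?addr_ge0 ?powR_ge0.
pose E k := [set w | beta ^+ k <= tc k w].
have mE k : measurable (E k).
  have := mtc k measurableT _ (measurable_itv `[beta ^+ k, +oo[).
  congr measurable; apply/seteqP; split => w /=; rewrite in_itv/= andbT; first by case.
  by move=> h; split.
exists (lim_sup_set E); split.
- by apply: bigcap_measurable => // k _; exact: bigcup_measurable.
- apply: (@borel_cantelli_geometric _ _ _ _ _ (4 * K) (alpha / beta)) => //.
  by rewrite divr_ge0 ?(ltW a0) ?(ltW b0)//= ltr_pdivrMr// mul1r.
  near=> k.
  have bk0 : 0 < beta ^+ k by rewrite exprn_gt0.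
  have mtcE : measurable_fun [set: W] (EFin \o tc k) by exact/measurable_EFinP.
  have markov := le_integral_abse P measurableT mtcE bk0.
  have EE : (\int[P]_w `|(EFin \o tc k) w| = (total_cost (fun=> r) c (3 * L k) (N k))%:E)%E.
    rewrite -(total_cost_expectation P omega omega01 omega_iid s r c (b k))//.
    by apply: eq_integral => w _ /=; rewrite ger0_norm// tc0.
  have SE : setT `&` [set x | ((beta ^+ k)%:E <= `|(EFin \o tc k) x|)%E] =
      [set w | beta ^+ k <= tc k w].
    by rewrite setTI; apply/seteqP; split => w /=; rewrite lee_fin ger0_norm.
  rewrite EE SE in markov.
  rewrite -(@lee_pmul2l _ (beta ^+ k)%:E)//.
  apply: (le_trans markov); rewrite -EFinM lee_fin.
  apply: (le_trans (total_cost_cst_le _ _ _ _ r0 c0 q1)); rewrite -/K.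
  have -> : beta ^+ k * (4 * K * (alpha / beta) ^+ k) = 4 * alpha ^+ k * K.
    by rewrite expr_div_n; field; rewrite gt_eqF.
  have ak1 : 1 <= alpha ^+ k by rewrite exprn_ege1// ltW.
  have Lk : (L k)%:R <= alpha ^+ k by rewrite truncn_le// (le_trans ler01).
  by rewrite ler_wpM2r// -natr1 natrM; lra.
- move=> w /= notnear; apply: contrapT => nE; apply: notnear.
  apply: filterS (near_notin_lim_sup _ _ nE) => k /negP; rewrite -ltNge.
  exact: ltW.
Unshelve. all: by end_near. Qed.

End environment_cost.

(** * Separation of the two walks under the quenched law *)

(** Since [c ^+ k] grows faster than linearly in [k], already by the quadratic
    term of the exponential series. *)
Lemma expr_le_expR_expr {R : realType} (B c h : R) : 0 < B -> 1 < c -> 0 < h ->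
  \forall k \near \oo, B ^+ k <= expR (h * c ^+ k).
Proof.
move=> B0 c1 h0; near=> k.
have lnc : 0 < ln c by rewrite ln_gt0.
rewrite -[B]lnK ?posrE// -expRM_natl ler_expR.
have ck : k%:R ^+ 2 * (ln c ^+ 2 / 2) <= c ^+ k.
  rewrite -[c in leRHS]lnK ?posrE ?(lt_trans ltr01)// -expRM_natl.
  apply: (@le_trans _ _ (1 + (k%:R * ln c) ^+ 2 / 2`!%:R)); last first.
    by apply: expR_ge1Dxn; rewrite mulr_ge0// ltW.
  by rewrite (_ : 2`!%:R = 2)// exprMn mulrA lerDr.
apply: (@le_trans _ _ (h * (k%:R ^+ 2 * (ln c ^+ 2 / 2)))); last by rewrite ler_pM2l.
have hc : 0 < h * (ln c ^+ 2 / 2) by rewrite mulr_gt0// divr_gt0// exprn_gt0.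
have : ln B / (h * (ln c ^+ 2 / 2)) <= k%:R by near: k; exact: nbhs_infty_ger.
rewrite ler_pdivrMr// => hk.
rewrite mulrCA expr2 -mulrA ler_wpM2l//.
Unshelve. all: by end_near. Qed.

(** Chernoff's bound: [y |-> expR (theta * (y - l))] dominates the indicator and
    one step multiplies it by the hyperbolic cosine of [theta], which is at most
    [(1 - theta ^+ 2)^-1 <= 1 + 2 * theta ^+ 2]. *)
Lemma srw_upper_tail {R : realType} (l z : int) (theta : R) n :
  0 <= theta <= 2^-1 ->
  iter n (nn_step (fun=> 2^-1)) (\1_[set y : int | l <= y]) z <=
  expR (n%:R * (2 * theta ^+ 2) + theta * (z - l)%:~R).
Proof.
move=> /andP[th0 th2].
have p1 : 0 < 1 - theta by lra.
have p2 : 0 < 1 + theta by lra.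
have half01 : 0 <= (2^-1 : R) <= 1 by apply/andP; split; lra.
pose psi (y : int) := expR (theta * (y - l)%:~R).
have cosh_le : (expR theta + expR (- theta)) / 2 <= expR (2 * theta ^+ 2).
  have h1 : expR theta <= (1 - theta)^-1.
    rewrite -[expR theta]invrK lef_pV2 ?posrE ?invr_gt0 ?expR_gt0//.
    by rewrite -expRN; apply: expR_ge1Dx.
  have h2 : expR (- theta) <= (1 + theta)^-1.
    by rewrite expRN lef_pV2 ?posrE ?expR_gt0 ?expR_ge1Dx//.
  apply: le_trans (expR_ge1Dx _).
  apply: (@le_trans _ _ (((1 - theta)^-1 + (1 + theta)^-1) / 2)).
    by rewrite ler_pM2r// lerD.
  have -> : ((1 - theta)^-1 + (1 + theta)^-1) / 2 = ((1 - theta) * (1 + theta))^-1.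
    by field; rewrite !lt0r_neq0.
  rewrite -[leRHS]invrK lef_pV2 ?posrE ?invr_gt0 ?mulr_gt0//; last first.
    by rewrite ltr_wpDr// mulr_ge0// sqr_ge0.
  rewrite -[leLHS]mul1r ler_pdivrMr.
    have u0 : 0 <= theta ^+ 2 by rewrite sqr_ge0.
    have u2 : theta ^+ 2 <= 2^-1 by rewrite expr2; nra.
    have -> : (1 - theta) * (1 + theta) * (1 + 2 * theta ^+ 2) =
        1 + theta ^+ 2 * (1 - 2 * theta ^+ 2) by ring.
    by rewrite lerDl mulr_ge0//; lra.
  by rewrite ltr_wpDr// mulr_ge0// sqr_ge0.
have stepE m : forall y, iter m (nn_step (fun=> 2^-1)) psi y <=
    expR (2 * theta ^+ 2) ^+ m * psi y.
  elim: m => [|m IH] y; first by rewrite mul1r.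
  rewrite iterS; pose v x := expR (2 * theta ^+ 2) ^+ m * psi x.
  apply: (@le_trans _ _ (nn_step (fun=> 2^-1) v y)); first exact: nn_step_mono.
  rewrite /nn_step /v (exprSr _ m) /psi.
  rewrite (_ : (y + 1 - l)%:~R = (y - l)%:~R + 1 :> R); last by rewrite -intrD1; congr _%:~R; lia.
  rewrite (_ : (y - 1 - l)%:~R = (y - l)%:~R - 1 :> R); last first.
    by rewrite -[1 in RHS]/(1%:~R) -intrB; congr _%:~R; lia.
  rewrite mulrDr mulrBr mulr1 !expRD.
  set u := expR (theta * _); set p := expR _ ^+ m.
  have u0 : 0 < u by apply: expR_gt0.
  have p0 : 0 <= p by rewrite exprn_ge0// expR_ge0.
  have := ler_wpM2l p0 (ler_wpM2l (ltW u0) cosh_le).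
  set a := expR theta; set c := expR (- theta); set g := expR (2 * _) => h.
  rewrite [leLHS](_ : _ = p * (u * ((a + c) / 2))); last by field.
  by rewrite [leRHS](_ : _ = p * (u * g))//; ring.
apply: le_trans (iter_nn_step_mono _ _ psi _ (fun=> half01) _ _) _.
  move=> y; rewrite indicE; case: (boolP (y \in _)) => [|_]; last exact: expR_ge0.
  rewrite inE /= => ly; rewrite -[1%:R]expR0 ler_expR mulr_ge0// ler0z; lia.
by apply: le_trans (stepE n z) _; rewrite -expRM_natl expRD.
Qed.

(** A power of [n] rounded so as to be constant on dyadic blocks: for
    [alpha = 2 `^ p] it is of order [n `^ p]. *)
Definition level {R : realType} (alpha : R) (n : nat) : nat :=
  Num.truncn (alpha ^+ trunc_log 2 n).

Section quenched.
Context {d} {T : measurableType d} {R : realType} (mu : {measure set T -> \bar R}).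
Hypothesis mu1 : mu [set: T] = 1%E.

(** In the block [k], take [theta = tau ^+ k] in Chernoff's bound.  The gain
    [theta * alpha ^+ k = (tau * alpha) ^+ k] must grow exponentially and
    beat the loss [4 * (2 * tau ^+ 2) ^+ k]: this asks for
    [alpha^-1 < tau < alpha / 2], which is possible exactly when
    [2 < alpha ^+ 2]. *)
Lemma srw_below_level (alpha : R) (x z : int) (Z : nat -> {mfun T >-> int}) :
  1 < alpha < 2 -> 2 < alpha ^+ 2 ->
  markov_chain mu (nearest_neighbour (fun=> 2^-1)) z Z ->
  mu (lim_sup_set (fun n => [set t | x + (level alpha n)%:Z < Z n t])) = 0%E.
Proof.
move=> /andP[a1 a_lt2] a2 chainZ.
have a0 : 0 < alpha by apply: lt_trans a1.
pose tau := (alpha^-1 + alpha / 2) / 2.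
have tau1 : alpha^-1 < alpha / 2.
  by rewrite -[alpha^-1]mul1r ltr_pdivrMr// mulrAC -expr2; lra.
have tau0 : 0 < tau by have : 0 < alpha^-1 by [rewrite invr_gt0]; rewrite /tau; lra.
have ta : 1 < tau * alpha.
  by rewrite -ltr_pdivrMr// mul1r /tau; lra.
have t2 : tau < alpha / 2 by rewrite /tau; lra.
move: tau tau0 ta t2 => tau tau0 ta t2.
have mF n : measurable [set t | x + (level alpha n)%:Z < Z n t].
  exact: (measurable_state _ _ [set y : int | x + (level alpha n)%:Z < y]).
apply: (@dyadic_borel_cantelli _ _ _ _ _ (expR `|(z - x)%:~R|)) => //.
have ev1 : \forall k \near \oo, (2 * tau / alpha) ^+ k <= 8^-1.
  have : `|2 * tau / alpha| < 1.
    rewrite ger0_norm ?divr_ge0 ?mulr_ge0 ?(ltW tau0) ?(ltW a0)//.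
    by rewrite ltr_pdivrMr// mul1r; lra.
  by move=> /cvg_expr /cvgr_le; apply; rewrite invr_gt0.
have ev2 := @expr_le_expR_expr R 4 (tau * alpha) 2^-1 ltac:(lra) ta ltac:(lra).
have ev3 : \forall k \near \oo, tau ^+ k <= 2^-1.
  have : `|tau| < 1 by rewrite ger0_norm ?(ltW tau0)//; lra.
  by move=> /cvg_expr /cvgr_le; apply; rewrite invr_gt0.
near=> k => n /andP[kn nk].
have lg : trunc_log 2 n = k by apply: trunc_log_eq; rewrite ?kn ?nk.
have -> : [set t | x + (level alpha n)%:Z < Z n t] =
    [set t | [set y : int | x + (level alpha n)%:Z + 1 <= y] (Z n t)].
  by apply/seteqP; split => t /=; lia.
rewrite (markov_chain_law mu mu1 _ _ _ chainZ) lee_fin.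
have th : 0 <= tau ^+ k <= 2^-1.
  by rewrite exprn_ge0 ?(ltW tau0)//=; near: k.
apply: le_trans (srw_upper_tail _ _ (tau ^+ k) n th) _.
have h1 : (2 * tau / alpha) ^+ k <= 8^-1 by near: k.
have h2 : 4 ^+ k <= expR (2^-1 * (tau * alpha) ^+ k) by near: k.
have -> : (z - (x + (level alpha n)%:Z + 1))%:~R =
    (z - x)%:~R - ((level alpha n)%:R + 1) :> R.
  by rewrite !(intrB, intrD); ring.
have lvl : alpha ^+ k <= (level alpha n)%:R + 1.
  by rewrite /level lg natr1 ltW// truncnS_gt.
apply: (@le_trans _ _ (expR (`|(z - x)%:~R| + - (2^-1 * (tau * alpha) ^+ k)))); last first.
  by rewrite expRD ler_wpM2l ?expR_ge0// exprVn expRN lef_pV2 ?posrE ?expR_gt0 ?exprn_gt0.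
have /andP[th0 th2] := th.
rewrite ler_expR mulrBr addrA lerBlDr.
have p1 : n%:R * (2 * (tau ^+ k) ^+ 2) <= 2^-1 * (tau * alpha) ^+ k.
  apply: (@le_trans _ _ ((2 ^ k.+1)%:R * (2 * (tau ^+ k) ^+ 2))).
    by rewrite ler_wpM2r ?mulr_ge0 ?sqr_ge0// ler_nat ltnW.
  have -> : (2 ^ k.+1)%:R * (2 * (tau ^+ k) ^+ 2) =
      4 * ((2 * tau / alpha) ^+ k * (tau * alpha) ^+ k).
    rewrite -exprMn (_ : 2 * tau / alpha * (tau * alpha) = 2 * tau ^+ 2); last first.
      by field; rewrite gt_eqF.
    by rewrite natrX exprMn -exprM -(exprM tau) mulnC exprS; ring.
  have := ler_wpM2r (exprn_ge0 k (ltW (lt_trans ltr01 ta))) h1; lra.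
have p2 : tau ^+ k * (z - x)%:~R <= `|(z - x)%:~R|.
  apply: (le_trans (ler_norm _)); rewrite normrM ger0_norm// -[leRHS]mul1r.
  by rewrite ler_wpM2r//; lra.
have p3 := ler_wpM2l th0 lvl; rewrite -exprMn in p3.
lra.
Unshelve. all: by end_near. Qed.

(** With [G = beta `^ s^-1 < 2], the total cost [A] is at most [G ^+ k], so that
    [(1 - A^-1) ^+ n] is at most [expR (- (2 / G) ^+ k)] for [n >= 2 ^ k], and
    [eta ^- L] is of order [expR (- ln eta * alpha ^+ k)].  Both are
    smaller than any geometric sequence. *)
Lemma rwre_above_level (a : int -> R) (s alpha beta eta : R) (x : int)
    (X : nat -> {mfun T >-> int}) :
  (forall y, 0 < a y < 1) -> markov_chain mu (nearest_neighbour a) x X ->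
  0 < s <= 1 -> 1 < eta -> 1 < alpha -> 0 < beta -> beta `^ s^-1 < 2 ->
  (\forall k \near \oo, let L := Num.truncn (alpha ^+ k) in
     total_cost (fun i => env_ratio a (x - L%:Z) i `^ s) (eta `^ s) (3 * L)
       (2 * L + 2 ^ k.+1).+1 <= beta ^+ k) ->
  mu (lim_sup_set (fun n => [set t | X n t <= x + (level alpha n)%:Z])) = 0%E.
Proof.
move=> a01 chainX s01 eta1 a1 b0 G2 cost.
have /andP[s0 s1] := s01.
have eta0 : 0 < eta by apply: lt_trans eta1.
pose G := beta `^ s^-1.
have G0 : 0 < G by rewrite powR_gt0.
have mF n : measurable [set t | X n t <= x + (level alpha n)%:Z].
  exact: (measurable_state _ _ [set y : int | y <= x + (level alpha n)%:Z]).
apply: (@dyadic_borel_cantelli _ _ _ _ _ (1 + 4 * eta)) => //.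
have G2' : 1 < 2 / G by rewrite ltr_pdivlMr// mul1r.
have lneta : 0 < ln eta by rewrite ln_gt0.
have G4 : 0 < 4 * G by rewrite mulr_gt0.
have G8 : 0 < 8 * G by rewrite mulr_gt0.
have ev1 := expr_le_expR_expr (4 * G) (2 / G) 1 G4 G2' ltr01.
have ev2 := expr_le_expR_expr (8 * G) alpha (ln eta) G8 a1 lneta.
near=> k.
pose L := Num.truncn (alpha ^+ k); pose N := (2 * L + 2 ^ k.+1).+1.
have costk : total_cost (fun i => env_ratio a (x - L%:Z) i `^ s) (eta `^ s) (3 * L) N <=
    beta ^+ k by rewrite /N /L; near: k.
have h1 : (4 * G) ^+ k <= expR (1 * (2 / G) ^+ k) by near: k.
have h2 : (8 * G) ^+ k <= expR (ln eta * alpha ^+ k) by near: k.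
move=> n /andP[kn nk].
have lg : trunc_log 2 n = k by apply: trunc_log_eq; rewrite ?kn ?nk.
rewrite (markov_chain_law mu mu1 a x X chainX n [set y | y <= x + (level alpha n)%:Z]).
rewrite lee_fin /level lg -/L.
pose A := total_cost (env_ratio a (x - L%:Z)) eta (3 * L) N.
have ratio0 i : 0 <= env_ratio a (x - L%:Z) i.
  by have /andP[? ?] := a01 (x - L%:Z + i%:Z); rewrite /env_ratio divr_ge0//; lra.
have A1 : 1 <= A by apply: total_cost_ge1.
have A0 : 0 < A by apply: lt_le_trans A1.
have AG : A <= G ^+ k.
  have As : A `^ s <= beta ^+ k.
    by apply: le_trans costk; apply: total_cost_powR => //; exact: ltW.
  rewrite -[A]powRr1 ?(ltW A0)// -[X in A `^ X](mulfV (lt0r_neq0 s0)) powRrM.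
  rewrite -powR_mulrn ?(ltW G0)// /G -[leRHS]powRrM [X in beta `^ X]mulrC [leRHS]powRrM.
  rewrite ge0_ler_powR ?nnegrE ?invr_ge0 ?powR_ge0// ?(ltW s0)//.
  by rewrite powR_mulrn// ltW.
have := @slow_walk_bound R a (x - L%:Z) eta A L N n a01 eta1.
rewrite subrK => /(_ _ _ erefl) bound.
have -> : x + L%:Z = x - L%:Z + (2 * L)%N%:Z by rewrite mul2n -addnn PoszD addrA subrK.
apply: le_trans (bound _ _) _.
- by rewrite /N ltnS leq_addr.
- by rewrite /N ltnS leq_add//; [rewrite mul2n -addnn leq_addr|exact: ltnW].
rewrite [leRHS]mulrDl mul1r; apply: lerD.
  have h : (1 - A^-1) ^+ n <= expR (- (2 / G) ^+ k).
    apply: (@le_trans _ _ (expR (- A^-1) ^+ n)).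
      rewrite lerXn2r ?nnegrE ?expR_ge0 ?subr_ge0 ?invf_le1//.
      exact: expR_ge1Dx.
    rewrite -expRM_natl ler_expR mulrN lerN2 expr_div_n.
    apply: (@le_trans _ _ (2 ^+ k * A^-1)).
      by rewrite ler_wpM2l ?exprn_ge0// lef_pV2 ?posrE ?exprn_gt0.
    by rewrite ler_wpM2r ?invr_ge0 ?(ltW A0)// -natrX ler_nat.
  apply: (@le_trans _ _ (G ^+ k * expR (- (2 / G) ^+ k))).
    by apply: ler_pM => //; [exact: ltW|rewrite exprn_ge0// subr_ge0 invf_le1].
  rewrite expRN exprVn ler_pdivrMr ?expR_gt0// [leRHS]mulrC ler_pdivlMr ?exprn_gt0//.
  by rewrite -exprMn mulrC -[X in expR X]mul1r.
have etaL : eta ^- L <= eta * expR (- (ln eta * alpha ^+ k)).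
  rewrite expRN -[leRHS]invrK invfM invrK lef_pV2 ?posrE ?exprn_gt0 ?mulr_gt0 ?invr_gt0 ?expR_gt0//.
  rewrite mulrC ler_pdivrMr// -exprSr -[eta in leRHS]lnK ?posrE// -expRM_natl ler_expR.
  by rewrite mulrC ler_wpM2r ?(ltW lneta)// ltW// truncnS_gt.
apply: (@le_trans _ _ ((2 ^ k.+1)%:R * ((2 * G ^+ k) * (eta * expR (- (ln eta * alpha ^+ k)))))).
  apply: ler_pM => //.
  - by rewrite mulr_ge0 ?invr_ge0 ?exprn_ge0 ?(ltW eta0)// addr_ge0// ltW.
  - by rewrite ler_nat ltnW.
  - apply: ler_pM => //; first by rewrite addr_ge0// ltW.
      by rewrite invr_ge0 exprn_ge0// ltW.
    lra.
have -> : (2 ^ k.+1)%:R * ((2 * G ^+ k) * (eta * expR (- (ln eta * alpha ^+ k)))) =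
    4 * eta * ((2 * G) ^+ k * expR (- (ln eta * alpha ^+ k))).
  by rewrite natrX exprMn exprS; ring.
rewrite ler_wpM2l ?mulr_ge0 ?(ltW eta0)//.
rewrite expRN exprVn ler_pdivrMr ?expR_gt0// [leRHS]mulrC ler_pdivlMr ?exprn_gt0//.
by rewrite -exprMn (_ : 2 * G * 4 = 8 * G)//; ring.
Unshelve. all: by end_near. Qed.

End quenched.

(** * Finitely many meetings *)

Theorem proposition1p2 (R : realType) (d : nat) (hd : (1 <= d)%N)
    (dW : measure_display) (W : measurableType dW) (P : probability W R)
    (omega : int -> {RV P >-> R})
    (omega01 : forall x w, 0 < omega x w < 1)
    (omega_iid : iid omega)
    (elliptic : exists eps0 : R, 0 < eps0 < 2^-1 /\
       P [set w | eps0 <= omega 0 w <= 1 - eps0] = 1%E)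
    (transient : ('E_P[fun w => ln (rho omega 0 w)%R] < 0)%E)
    (hkappa : exists kappa : R,
       [/\ 0 < kappa, ('E_P[fun w => (rho omega 0 w `^ kappa)%R] = 1)%E & 2^-1 < kappa])
    (dT : measure_display) (T : measurableType dT)
    (S : 'I_d -> nat -> {mfun T >-> int}) (Z : nat -> {mfun T >-> int})
    (x : 'I_d -> int) (z1 : int) (Pq : R.-pker W ~> T)
    (quenched : forall w, quenched_law (Pq w) (fun y => omega y w) x z1 S Z) :
  {ae annealed_law P Pq, forall t,
    finite_set [set n | forall j : 'I_d, S j n t = Z n t]}.
Proof.
have [kappa [k0 critical khalf]] := hkappa.
pose s := (2^-1 + Num.min kappa 1) / 2.
have s_lo : 2^-1 < s.
  by rewrite /s; have : 2^-1 < Num.min kappa 1 by [rewrite lt_min khalf/=; lra]; lra.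
have [s_kappa s1] : s < kappa /\ s < 1.
  rewrite /s; have : Num.min kappa 1 <= kappa by [rewrite ge_min lexx].
  by have : Num.min kappa 1 <= 1 by [rewrite ge_min lexx orbT]; split; lra.
have s0 : 0 < s by lra.
have [|r [/andP[r0 r1] rE]] := subcritical_moment P omega omega01 kappa s transient critical.
  by rewrite s0.
clearbody s.
pose c := 2 / (1 + r).
have rp : 0 < 1 + r by lra.
have c1 : 1 < c by rewrite /c ltr_pdivlMr//; lra.
have q1 : c * r < 1 by rewrite /c mulrAC ltr_pdivrMr//; lra.
have c0 : 0 < c by lra.
clearbody c.
pose eta := c `^ s^-1.
have etaE : eta `^ s = c by rewrite /eta -powRrM mulVf ?lt0r_neq0// powRr1// ltW.
have eta1 : 1 < eta.
  by rewrite /eta /powR gt_eqF// -expR0 ltr_expR mulr_gt0 ?invr_gt0// ln_gt0.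
pose ln2 : R := ln 2.
have ln2_gt0 : 0 < ln2 by rewrite /ln2 ln_gt0// ltr1n.
have expln2 : expR ln2 = 2 by rewrite /ln2 lnK// posrE.
(* [alpha = 2 `^ p] and [beta = 2 `^ q] with [1/2 < p < q < s] equally spaced. *)
pose alpha := expR ((2^-1 + (s - 2^-1) / 3) * ln2).
pose beta := expR ((2^-1 + 2 * (s - 2^-1) / 3) * ln2).
have a1 : 1 < alpha by rewrite -expR0 ltr_expR mulr_gt0//; lra.
have ab : alpha < beta by rewrite ltr_expR ltr_pM2r//; lra.
have a2 : alpha < 2 by rewrite -expln2 ltr_expR gtr_pMl//; lra.
have aa2 : 2 < alpha ^+ 2.
  rewrite -expln2 -expRM_natl ltr_expR mulrA ltr_pMl//; lra.
have beta0 : 0 < beta by exact: expR_gt0.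
have beta2 : beta `^ s^-1 < 2.
  rewrite /powR gt_eqF// expRK -[ltRHS]expln2 ltr_expR mulrA gtr_pMl//.
  by rewrite ltr_pdivrMl// mulr1; lra.
pose j0 : 'I_d := Ordinal hd.
pose L k := Num.truncn (alpha ^+ k).
pose N k := (2 * L k + 2 ^ k.+1).+1.
have aab : 1 < alpha < beta by rewrite a1 ab.
have env0 := total_cost_eventually_le P omega omega01 omega_iid s r c alpha beta
  (fun k => x j0 - (L k)%:Z) N r0 rE (ltW c0) q1 aab.
pose slow n := [set t | S j0 n t <= x j0 + (level alpha n)%:Z].
pose high n := [set t | x j0 + (level alpha n)%:Z < Z n t].
pose bad := lim_sup_set slow `|` lim_sup_set high.
have mslow n : measurable (slow n).
  exact: (measurable_state _ _ [set y : int | y <= x j0 + (level alpha n)%:Z]).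
have mhigh n : measurable (high n).
  exact: (measurable_state _ _ [set y : int | x j0 + (level alpha n)%:Z < y]).
have mlim F : (forall n, measurable (F n)) -> measurable (lim_sup_set F : set T).
  by move=> mF; apply: bigcap_measurable => // k _; exact: bigcup_measurable.
have mbad : measurable bad by apply: measurableU; exact: mlim.
(* One measurable event of the path space, null under the quenched law of almost
   every environment, contains all the paths with infinitely many meetings. *)
exists bad; split => //.
- rewrite /annealed_law -[RHS](integral0 P setT).
  apply: ae_eq_integral => //; first exact: measurable_kernel.
  near=> w => _.
  have envw : \forall k \near \oo,
      total_cost (fun i => rho omega (x j0 - (L k)%:Z + i%:Z) w `^ s) c
        (3 * L k) (N k) <= beta ^+ k.
    by near: w; exact: env0.
  have [chainS chainZ _] := quenched w.
  have Q1 : Pq w [set: T] = 1%E by exact: prob_kernel.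
  have slow0 : Pq w (lim_sup_set slow) = 0%E.
    apply: (@rwre_above_level _ _ _ (Pq w) Q1 (fun y => omega y w) s alpha beta eta) => //.
    + by rewrite s0 ltW.
    + by rewrite etaE.
  have high0 : Pq w (lim_sup_set high) = 0%E.
    by apply: (@srw_below_level _ _ _ (Pq w) Q1 alpha (x j0) z1) => //; apply/andP.
  by apply: null_set_setU => //; exact: mlim.
- move=> t /= infinite; apply: contrapT => notbad.
  have [ns nh] : ~ lim_sup_set slow t /\ ~ lim_sup_set high t by apply/not_orP.
  have [K1 _ notslow] := near_notin_lim_sup _ _ ns.
  have [K2 _ nothigh] := near_notin_lim_sup _ _ nh.
  apply: infinite; apply: (@sub_finite_set _ _ `I_(K1 + K2)) => //.
  move=> n /= meet; rewrite ltnNge; apply/negP => Kn.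
  have /negP := notslow n (leq_trans (leq_addr _ _) Kn).
  have /negP := nothigh n (leq_trans (leq_addl _ _) Kn).
  by rewrite /= -(meet j0) -leNgt => ->.
Unshelve. all: by end_near. Qed.
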